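(* Let $A$ be an artin algebra. If the global dimension of $A$ is at most $2$, then $A$ is a right-strongly (resp. left-strongly) quasi-hereditary algebra.
   Context: All modules are finitely generated. Let $\{S(i)\mid i\in I\}$ be a complete set of representatives of isomorphism classes of simple right $A$-modules, and $P(i)$ the projective cover of $S(i)$. Given a partial order $\le$ on $I$, the standard module $\Delta(i)$ is the maximal factor module of $P(i)$ all of whose composition factors have the form $S(j)$ with $j\le i$. $\mathcal F(\Delta)$ is the full subcategory of modules $M$ having a chain of submodules $M=M_0\supseteq M_1\supseteq\cdots\supseteq M_l=0$ whose successive quotients are each isomorphic to some standard module $\Delta(j)$; $(M:\Delta(j))$ denotes the number of quotients isomorphic to $\Delta(j)$ (filtration multiplicity). The pair $(A,\le)$ is right-strongly quasi-hereditary if for every $i\in I$ we have $[\Delta(i):S(i)]=1$ (composition multiplicity), and the kernel $K(i)$ in the short exact sequence $0\to K(i)\to P(i)\to\Delta(i)\to0$ satisfies: (a) $K(i)\in\mathcal F(\Delta)$; (b) if $(K(i):\Delta(j))\ne0$ then $i<j$; (c) $K(i)$ is a projective right $A$-module (equivalently, $\Delta(i)$ has projective dimension at most one). The pair $(A,\le)$ is left-strongly quasi-hereditary if $(A^{\mathrm{op}},\le)$ is right-strongly quasi-hereditary. $A$ is called right-strongly (resp. left-strongly) quasi-hereditary if $(A,\le)$ is so for some partial order $\le$ on $I$ (the orders for the right and the left version may differ). *)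

(* Defs.v *)
From HB Require Import structures.
From mathcomp Require Import all_boot all_order all_algebra.

Set Implicit Arguments.
Unset Strict Implicit.
Unset Printing Implicit Defensive.

Import GRing.Theory.
Local Open Scope ring_scope.

(* Everything down to [strongly_quasi_hereditary_pair] is about left modules   *)
(* over a ring R; right A-modules are the left modules over the converse ring  *)
(* A^c.                                                                        *)

Section Modules.
Variable R : nzRingType.
Implicit Types M N P : lmodType R.

Definition zero_module M : Prop := forall x : M, x = 0.

Definition surj M N (f : M -> N) : Prop := forall y, exists x, f x = y.

Definition exact M N P (f : M -> N) (g : N -> P) : Prop :=
  forall y, g y = 0 <-> exists x, f x = y.

Definition short_exact M N P (f : M -> N) (g : N -> P) : Prop :=
  [/\ injective f, exact f g & surj g].

Definition isomorphic M N : Prop := exists f : {linear M -> N}, bijective f.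

Definition submodule M (U : M -> Prop) : Prop :=
  U 0 /\ forall (a : R) x y, U x -> U y -> U (a *: x + y).

Definition finitely_generated M : Prop :=
  exists (n : nat) (g : 'I_n -> M),
    forall x, exists c : 'I_n -> R, x = \sum_(i < n) c i *: g i.

Definition artinian M : Prop :=
  forall U : nat -> M -> Prop,
    (forall n, submodule (U n)) ->
    (forall n x, U n.+1 x -> U n x) ->
    exists n, forall m, (n <= m)%N -> forall x, U n x -> U m x.

Definition simple_module M : Prop :=
  ~ zero_module M /\
  forall U : M -> Prop, submodule U ->
    (forall x, U x -> x = 0) \/ (forall x, U x).

Definition projective P : Prop :=
  forall (M N : lmodType R) (g : {linear M -> N}) (f : {linear P -> N}),
    surj g -> exists h : {linear P -> M}, forall x, g (h x) = f x.

Definition superfluous M (U : M -> Prop) : Prop :=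
  forall V : M -> Prop, submodule V ->
    (forall x, exists u v, [/\ U u, V v & x = u + v]) -> forall x, V x.

Definition projective_cover P M (p : {linear P -> M}) : Prop :=
  [/\ projective P, surj p & superfluous (fun x => p x = 0)].

(* A resolution ... -> P 1 -> P 0 -> M -> 0 with P i = 0 for i > n.            *)
Definition proj_dim_le (n : nat) M : Prop :=
  exists (P : nat -> lmodType R) (d : forall i, {linear P i.+1 -> P i})
         (e : {linear P 0%N -> M}),
    [/\ forall i, projective (P i) /\ finitely_generated (P i),
        surj e,
        exact (d 0%N) e,
        forall i, exact (d i.+1) (d i)
      & forall i, (n < i)%N -> zero_module (P i)].

Definition gl_dim_le (n : nat) : Prop :=
  forall M, finitely_generated M -> proj_dim_le n M.

(* U / V is isomorphic to X, for submodules V of U of M: the isomorphism is    *)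
(* given by a function f whose restriction to U is linear and onto X, with     *)
(* kernel V; the values of f outside U are irrelevant.                         *)
Definition subquotient_iso M (U V : M -> Prop) (X : lmodType R) : Prop :=
  exists f : M -> X,
    [/\ forall a x y, U x -> U y -> f (a *: x + y) = a *: f x + f y,
        forall z, exists2 x, U x & f x = z
      & forall x, U x -> (f x = 0 <-> V x)].

Section Filtrations.
Variables (I : finType) (X : I -> lmodType R).

(* M = U 0 >= U 1 >= ... >= U l = 0 with U k / U k.+1 isomorphic to X (t k).   *)
Definition filtration M (l : nat) (t : 'I_l -> I) : Prop :=
  exists U : nat -> M -> Prop,
    [/\ forall k, submodule (U k),
        forall x, U 0%N x,
        forall x, U l x -> x = 0,
        forall k x, U k.+1 x -> U k x
      & forall k : 'I_l, subquotient_iso (U k) (U k.+1) (X (t k))].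

Definition multiplicity (l : nat) (t : 'I_l -> I) (j : I) : nat :=
  #|[set k | t k == j]|.

End Filtrations.

Section Standard.
Variables (I : finType) (S P : I -> lmodType R) (le : rel I).

Definition complete_simples : Prop :=
  [/\ forall i, simple_module (S i),
      forall i j, isomorphic (S i) (S j) -> i = j
    & forall M, simple_module M -> exists i, isomorphic M (S i)].

(* As the S j are simple, a filtration by S is a composition series.           *)
Definition comp_factors_le (i : I) M : Prop :=
  exists (l : nat) (t : 'I_l -> I), filtration S M t /\ forall k, le (t k) i.

Definition comp_mult (i : I) M (m : nat) : Prop :=
  exists (l : nat) (t : 'I_l -> I), filtration S M t /\ multiplicity t i = m.

(* q presents D as the largest factor module of P i with composition factors   *)
(* S j, j <= i: any other such factor module of P i is a factor module of D.   *)
Definition standard_module (i : I) (D : lmodType R) (q : {linear P i -> D}) :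
  Prop :=
  [/\ surj q, comp_factors_le i D
    & forall (D' : lmodType R) (q' : {linear P i -> D'}),
        surj q' -> comp_factors_le i D' -> forall x, q x = 0 -> q' x = 0].

Definition strongly_quasi_hereditary_pair : Prop :=
  exists (D : I -> lmodType R) (q : forall i, {linear P i -> D i}),
    (forall i, standard_module (q i)) /\
    forall i,
      comp_mult i (D i) 1 /\
      exists (K : lmodType R) (u : {linear K -> P i}),
        [/\ short_exact u (q i),
            projective K
          & exists (l : nat) (t : 'I_l -> I),
              filtration D K t /\
              forall j, multiplicity t j <> 0%N -> le i j /\ i <> j].

End Standard.

End Modules.

Definition right_gl_dim_le (A : nzRingType) (n : nat) : Prop :=
  gl_dim_le A^c n.

Definition right_strongly_quasi_hereditary (A : nzRingType) : Prop :=
  exists (I : finType) (S P : I -> lmodType A^c)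
         (p : forall i, {linear P i -> S i}) (le : rel I),
    [/\ complete_simples S,
        forall i, projective_cover (p i),
        [/\ reflexive le, antisymmetric le & transitive le]
      & strongly_quasi_hereditary_pair S P le].

Definition left_strongly_quasi_hereditary (A : nzRingType) : Prop :=
  right_strongly_quasi_hereditary A^c.

Definition artin_algebra (k : comNzRingType) (A : algType k) : Prop :=
  artinian (k^o : lmodType k) /\ finitely_generated (A : lmodType k).

(* Main.v *)
Require Import Defs.
From HB Require Import structures.
From mathcomp Require Import all_boot all_order all_algebra.
From mathcomp Require Import boolp classical_sets.

(* Over an artin algebra, global dimension at most 2 only enters through the
   fact that the kernel of a map between finitely generated projective
   modules is projective. This property passes to the opposite algebra: if
   [n] generates the left kernel of a matrix and [a] generates the relations
   of [n], projectivity of the right kernel of [a] yields an idempotent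
   matrix that splits the presentation given by [n] and [a]. So it suffices
   to treat one side.

   For a set [J] of indices let [tr_J M] be the trace in [M] of the [P j]
   with [j] in [J]. Starting from the set of all indices, we remove indices
   one at a time, keeping the invariant that [tr_J M] is projective for all
   finitely generated projective [M]; the order of removal is the wanted
   total order. To find the next index, fix [j] in [J] and take a nonzero
   map [f : P i -> P j], [i] in [J], with minimal image. By minimality [f]
   kills [T := tr_J (rad P i)], so that [T = tr_J (ker f)] is projective. It
   has no summand [P i], since that would give an injective endomorphism of
   [P i] with image in the radical; hence [T = tr_(J \ i) (P i)]. So [P i /
   T] is the standard module, its kernel [T] is projective, and the
   invariant holds for [J \ i]. *)

Set Implicit Arguments.
Unset Strict Implicit.
Unset Printing Implicit Defensive.

Import GRing.Theory.
Local Open Scope ring_scope.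
Local Open Scope classical_set_scope.
Local Open Scope quotient_scope.

(** * Submodules and quotient modules *)

Section Submodules.
Variable R : nzRingType.
Implicit Types M N Q : lmodType R.

Definition mklin M N (f : M -> N)
    (fP : forall a x y, f (a *: x + y) = a *: f x + f y) : {linear M -> N} :=
  HB.pack f (GRing.isLinear.Build R M N *:%R f fP).

Lemma submodule0 M (U : set M) : submodule U -> U 0.
Proof. by case. Qed.

Lemma submoduleD M (U : set M) x y : submodule U -> U x -> U y -> U (x + y).
Proof. by case=> _ h Ux Uy; have := h 1 x y Ux Uy; rewrite scale1r. Qed.

Lemma submoduleZ M (U : set M) a x : submodule U -> U x -> U (a *: x).
Proof. by case=> U0 h Ux; have := h a x 0 Ux U0; rewrite addr0. Qed.

Lemma submoduleN M (U : set M) x : submodule U -> U x -> U (- x).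
Proof. by move=> hU Ux; rewrite -scaleN1r; apply: submoduleZ. Qed.

Lemma submoduleB M (U : set M) x y : submodule U -> U x -> U y -> U (x - y).
Proof. by move=> hU Ux Uy; apply: submoduleD => //; apply: submoduleN. Qed.

Lemma submodule_sum M (U : set M) (T : Type) (s : seq T) (p : pred T)
    (F : T -> M) :
  submodule U -> (forall i, p i -> U (F i)) -> U (\sum_(i <- s | p i) F i).
Proof.
move=> hU hF; apply: big_ind => //; first exact: submodule0.
by move=> x y; apply: submoduleD.
Qed.

Lemma submoduleT M : submodule [set: M].
Proof. by []. Qed.

Lemma submodule_zero M : submodule [set 0 : M].
Proof. by split=> // a x y /= -> ->; rewrite scaler0 addr0. Qed.

Lemma submoduleI M (U V : set M) :
  submodule U -> submodule V -> submodule (U `&` V).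
Proof.
move=> [U0 hU] [V0 hV]; split=> // a x y [Ux Vx] [Uy Vy].
by split; [apply: hU | apply: hV].
Qed.

Lemma submodule_preim M N (f : {linear M -> N}) (V : set N) :
  submodule V -> submodule (f @^-1` V).
Proof.
move=> [V0 hV]; split; first by rewrite /preimage /= linear0.
by move=> a x y; rewrite /preimage /= linearP; apply: hV.
Qed.

Lemma submodule_im M N (f : {linear M -> N}) (U : set M) :
  submodule U -> submodule (f @` U).
Proof.
move=> [U0 hU]; split; first by exists 0 => //; rewrite linear0.
move=> a _ _ [x Ux <-] [y Uy <-]; exists (a *: x + y); first exact: hU.
by rewrite linearP.
Qed.

Definition kernel M N (f : M -> N) : set M := [set x | f x = 0].

Lemma submodule_ker M N (f : {linear M -> N}) : submodule (kernel f).
Proof. exact: (submodule_preim f (submodule_zero N)). Qed.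

Lemma submodule_range M N (f : {linear M -> N}) : submodule (range f).
Proof. exact: submodule_im. Qed.

Definition subsum M (U V : set M) : set M :=
  [set x | exists u v, [/\ U u, V v & x = u + v]].

Lemma submodule_subsum M (U V : set M) :
  submodule U -> submodule V -> submodule (subsum U V).
Proof.
move=> [U0 hU] [V0 hV]; split; first by exists 0, 0; rewrite addr0.
move=> a _ _ [u [v [Uu Vv ->]]] [u' [v' [Uu' Vv' ->]]].
exists (a *: u + u'), (a *: v + v'); split; [exact: hU | exact: hV |].
by rewrite scalerDr addrACA.
Qed.

Lemma subsumUl M (U V : set M) : submodule V -> U `<=` subsum U V.
Proof. by move=> [V0 _] x Ux; exists x, 0; rewrite addr0. Qed.

Lemma subsumUr M (U V : set M) : submodule U -> V `<=` subsum U V.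
Proof. by move=> [U0 _] x Vx; exists 0, x; rewrite add0r. Qed.

Lemma subsumS M (U V U' V' : set M) :
  U `<=` U' -> V `<=` V' -> subsum U V `<=` subsum U' V'.
Proof.
move=> hU hV _ [u [v [Uu Vv ->]]].
by exists u, v; split=> //; [apply: hU | apply: hV].
Qed.

Section SubmoduleType.
Variables (M : lmodType R) (U : set M) (hU : submodule U).

(** The argument records the proof that [U] is a submodule, so that the closure instance, and with
    it the module structure, can be attached to the predicate. *)
Definition submodule_pred of submodule U : {pred M} := fun x => `[<U x>].

Fact submodule_pred_closed : submod_closed (submodule_pred hU).
Proof.
split=> [|a x y /asboolP Ux /asboolP Uy]; apply/asboolP.
  exact: submodule0.
by case: hU => _; apply.
Qed.

HB.instance Definition _ :=
  GRing.isSubmodClosed.Build R M (submodule_pred hU) submodule_pred_closed.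

Record submodule_type := SubmoduleType {
  submodule_val : M; _ : submodule_val \in submodule_pred hU }.

HB.instance Definition _ := [isSub for submodule_val].
HB.instance Definition _ := [Choice of submodule_type by <:].
HB.instance Definition _ := [SubChoice_isSubLmodule of submodule_type by <:].

(** Later proofs turn a submodule into a module only through such an embedding, never through the
    carrier [submodule_type]. *)
Lemma submodule_ex : exists (N : lmodType R) (i : {linear N -> M}),
  injective i /\ range i = U.
Proof.
exists submodule_type, (val : {linear submodule_type -> M}); split.
  exact: val_inj.
apply/seteqP; split=> [_ [x _ <-]|x Ux].
  by case: x => x /= /asboolP.
have Ux' : x \in submodule_pred hU by apply/asboolP.
by exists (SubmoduleType Ux').
Qed.

(** * Quotient modules *)

Definition quotient_rel : rel M := fun x y => `[<U (x - y)>].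

Fact quotient_rel_equiv : equiv_class_of quotient_rel.
Proof.
split=> [x|x y|y x z].
- by apply/asboolP; rewrite subrr; apply: submodule0.
- by apply/asboolP/asboolP => /(submoduleN hU); rewrite opprB.
move=> /asboolP xy /asboolP yz; apply/asboolP.
by have := submoduleD hU xy yz; rewrite addrA subrK.
Qed.

Canonical quotient_equiv : equiv_rel M :=
  EquivRelPack quotient_rel_equiv.

Definition quotient_type of submodule U := {eq_quot quotient_equiv}.
HB.instance Definition _ := Choice.on (quotient_type hU).

Let pi (x : M) : quotient_type hU := \pi_{eq_quot quotient_equiv} x.
Let rep (x : quotient_type hU) : M :=
  repr (x : {eq_quot quotient_equiv}).

Lemma quotient_piP x y : pi x = pi y <-> U (x - y).
Proof.
split=> [/eqmodP /asboolP //|Uxy]; apply/eqmodP; exact/asboolP.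
Qed.

Let repK x : pi (rep x) = x.
Proof. exact: reprK. Qed.

Let pi_rep x : U (rep (pi x) - x).
Proof. by apply/quotient_piP; rewrite repK. Qed.

Let qadd x y := pi (rep x + rep y).
Let qopp x := pi (- rep x).
Let qscale (a : R) x := pi (a *: rep x).

Let pi_add x y : qadd (pi x) (pi y) = pi (x + y).
Proof.
apply/quotient_piP; rewrite opprD addrACA.
by apply: submoduleD => //; apply: pi_rep.
Qed.

Let pi_opp x : qopp (pi x) = pi (- x).
Proof.
by apply/quotient_piP; rewrite -opprD; apply: submoduleN => //; apply: pi_rep.
Qed.

Let pi_scale a x : qscale a (pi x) = pi (a *: x).
Proof.
apply/quotient_piP; rewrite -scalerBr.
by apply: submoduleZ => //; apply: pi_rep.
Qed.

Fact quotient_addA : associative qadd.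
Proof.
move=> x y z; rewrite -(repK x) -(repK y) -(repK z).
by rewrite !pi_add addrA.
Qed.
Fact quotient_addC : commutative qadd.
Proof. by move=> x y; rewrite -(repK x) -(repK y) !pi_add addrC. Qed.
Fact quotient_add0 : left_id (pi 0) qadd.
Proof. by move=> x; rewrite -(repK x) !pi_add add0r. Qed.
Fact quotient_addN : left_inverse (pi 0) qopp qadd.
Proof. by move=> x; rewrite -(repK x) pi_opp pi_add addNr. Qed.

HB.instance Definition _ := GRing.isZmodule.Build (quotient_type hU)
  quotient_addA quotient_addC quotient_add0 quotient_addN.

Let piD x y : pi x + pi y = pi (x + y).
Proof. exact: pi_add. Qed.

Fact quotient_scaleA a b x : qscale a (qscale b x) = qscale (a * b) x.
Proof. by rewrite -(repK x) !pi_scale scalerA. Qed.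
Fact quotient_scale1 : left_id 1 qscale.
Proof. by move=> x; rewrite -(repK x) pi_scale scale1r. Qed.
Fact quotient_scaleDr : right_distributive qscale +%R.
Proof.
by move=> a x y; rewrite -(repK x) -(repK y) piD !pi_scale piD scalerDr.
Qed.
Fact quotient_scaleDl x : {morph qscale^~ x : a b / a + b}.
Proof. by move=> a b; rewrite /= -(repK x) !pi_scale piD scalerDl. Qed.

HB.instance Definition _ := GRing.Zmodule_isLmodule.Build R (quotient_type hU)
  quotient_scaleA quotient_scale1 quotient_scaleDr quotient_scaleDl.

Lemma quotient_ex : exists (N : lmodType R) (q : {linear M -> N}),
  surj q /\ kernel q = U.
Proof.
have piP a x y : pi (a *: x + y) = a *: pi x + pi y.
  by rewrite -piD; congr (_ + _); rewrite -[RHS]/(qscale a (pi x)) pi_scale.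
exists (quotient_type hU), (mklin piP); split=> [y|].
  by exists (rep y); apply: repK.
apply/predeqP => x; rewrite /kernel /=.
by split=> [/quotient_piP|Ux]; [|apply/quotient_piP]; rewrite subr0.
Qed.

End SubmoduleType.

(** A section of [q] chosen as a function need not be linear, but its composite with [f] is, because
    [f] is constant on the fibres of [q]. *)
Lemma factor_ex M N Q (q : {linear M -> Q}) (f : {linear M -> N}) :
  surj q -> kernel q `<=` kernel f ->
  exists h : {linear Q -> N}, forall x, h (q x) = f x.
Proof.
move=> qs qf; have [s sK] := choice qs.
have fE x y : q x = q y -> f x = f y.
  move=> qxy; apply/eqP; rewrite -subr_eq0 -linearB; apply/eqP/qf.
  by rewrite /kernel /= linearB qxy subrr.
have sP a x y : f (s (a *: x + y)) = a *: f (s x) + f (s y).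
  by rewrite -linearP; apply: fE; rewrite linearP !sK.
by exists (mklin sP) => x /=; apply: fE; rewrite sK.
Qed.

Lemma lift_ex M N Q (i : {linear N -> M}) (f : {linear Q -> M}) :
  injective i -> range f `<=` range i ->
  exists h : {linear Q -> N}, forall x, i (h x) = f x.
Proof.
move=> ii fi; have [s sK] : exists s : Q -> N, forall x, i (s x) = f x.
  suff /choice[s sK] : forall x, exists y, i y = f x by exists s.
  by move=> x; have [|y _ yx] := fi (f x); [exists x|exists y].
have sP a x y : s (a *: x + y) = a *: s x + s y.
  by apply: ii; rewrite linearP !sK linearP.
by exists (mklin sP).
Qed.

Lemma kernel_inj M N (f : {linear M -> N}) :
  kernel f `<=` [set 0] -> injective f.
Proof.
move=> kf x y fxy; apply/eqP; rewrite -subr_eq0; apply/eqP/kf.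
by rewrite /kernel /= linearB fxy subrr.
Qed.

Lemma inj_kernel M N (f : {linear M -> N}) x : injective f -> f x = 0 -> x = 0.
Proof. by move=> fi fx; apply: fi; rewrite fx linear0. Qed.

Lemma bij_isomorphic M N (f : {linear M -> N}) :
  injective f -> surj f -> isomorphic M N.
Proof.
move=> fi fs; have [g gK] := choice fs; exists f; exists g => // x.
by apply: fi; rewrite gK.
Qed.

Lemma isomorphic_sym M N : isomorphic M N -> isomorphic N M.
Proof.
move=> [f [g fK gK]].
have gP a x y : g (a *: x + y) = a *: g x + g y.
  by apply: (can_inj fK); rewrite linearP !gK.
by exists (mklin gP); exists f.
Qed.

Lemma isomorphic_trans M N Q :
  isomorphic M N -> isomorphic N Q -> isomorphic M Q.
Proof. by move=> [f fb] [g gb]; exists (g \o f); apply: bij_comp. Qed.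

End Submodules.

(** * Chain conditions *)

Definition subset_dir b (T : Type) (X Y : set T) :=
  if b then X `<=` Y else Y `<=` X.

(* The minimum condition ([b = true]) or the maximum condition ([b = false])
   on the submodules of [M] contained in [U]. *)
Definition chain_cond (R : nzRingType) b (M : lmodType R) (U : set M) : Prop :=
  forall F : set (set M),
    (exists X, [/\ submodule X, X `<=` U & F X]) ->
    exists X, [/\ submodule X, X `<=` U, F X &
      forall Y, submodule Y -> Y `<=` U -> F Y ->
        subset_dir b Y X -> subset_dir b X Y].

(** The extremal choice is made in two rounds: first [phi1 X] is made extremal, then [phi2 X] among
    the members that keep it so. A further comparable member has the same two images, and the last
    hypothesis then gives equality. *)
Lemma chain_cond_pull (R R1 R2 : nzRingType) b (M : lmodType R) (U : set M)
    (M1 : lmodType R1) (U1 : set M1) (M2 : lmodType R2) (U2 : set M2)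
    (phi1 : set M -> set M1) (phi2 : set M -> set M2) :
  chain_cond b U1 -> chain_cond b U2 ->
  (forall X, submodule X -> X `<=` U -> submodule (phi1 X) /\ phi1 X `<=` U1) ->
  (forall X, submodule X -> X `<=` U -> submodule (phi2 X) /\ phi2 X `<=` U2) ->
  (forall X Y, X `<=` Y -> phi1 X `<=` phi1 Y) ->
  (forall X Y, X `<=` Y -> phi2 X `<=` phi2 Y) ->
  (forall X Y, submodule X -> submodule Y -> Y `<=` U -> X `<=` Y ->
     phi1 Y `<=` phi1 X -> phi2 Y `<=` phi2 X -> Y `<=` X) ->
  chain_cond b U.
Proof.
move=> c1 c2 h1 h2 mono1 mono2 refl F [X0 [sX0 X0U FX0]].
pose F1 : set (set M1) := [set Z | exists X,
  [/\ submodule X, X `<=` U, F X & Z = phi1 X]].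
have [|_ [_ _ [X1 [sX1 X1U FX1 ->]] max1]] := c1 F1.
  by exists (phi1 X0); have [? ?] := h1 X0 sX0 X0U; split=> //; exists X0.
pose F2 : set (set M2) := [set Z | exists X, [/\ submodule X, X `<=` U, F X,
  subset_dir b (phi1 X) (phi1 X1) & Z = phi2 X]].
have [|_ [_ _ [X2 [sX2 X2U FX2 X21 ->]] max2]] := c2 F2.
  exists (phi2 X1); have [? ?] := h2 X1 sX1 X1U; split=> //; exists X1.
  by split=> //; case: (b).
exists X2; split=> // Y sY YU FY YX2.
have [s1Y Y1] := h1 Y sY YU; have [s2Y Y2] := h2 Y sY YU.
have trans (X Z T : set M1) :
    subset_dir b X Z -> subset_dir b Z T -> subset_dir b X T.
  by case: (b) => /= XZ ZT; [apply: subset_trans ZT | apply: subset_trans XZ].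
have Y12 : subset_dir b (phi1 Y) (phi1 X2).
  by move: YX2; case: (b); apply: mono1.
have Y11 := trans _ _ _ Y12 X21.
have rev1 : subset_dir b (phi1 X2) (phi1 Y).
  by apply: trans X21 _; apply: max1 => //; exists Y.
have rev2 : subset_dir b (phi2 X2) (phi2 Y).
  apply: max2 => //; first by exists Y.
  by move: YX2; case: (b); apply: mono2.
by move: YX2 rev1 rev2; case: (b) => /= *; apply: refl.
Qed.

Section ChainConditions.
Variable R : nzRingType.
Implicit Types (M N Q : lmodType R) (b : bool).

Lemma chain_condS b M (U V : set M) :
  V `<=` U -> chain_cond b U -> chain_cond b V.
Proof.
move=> VU cU F [X [sX XV FX]].
have [|Y [sY YU [FY YV] mY]] := cU [set Y | F Y /\ Y `<=` V].
  by exists X; split=> //; apply: subset_trans VU.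
exists Y; split=> // Z sZ ZV FZ ZY; apply: mY => //.
exact: subset_trans VU.
Qed.

Lemma chain_cond0 b M : chain_cond b [set 0 : M].
Proof.
move=> F [X [sX X0 FX]]; exists X; split=> // Y sY Y0 _ _.
case: b => /= x; first by move/X0->; apply: submodule0.
by move/Y0->; apply: submodule0.
Qed.

Lemma chain_cond_im b M N (f : {linear M -> N}) (U : set M) :
  submodule U -> chain_cond b U -> chain_cond b (f @` U).
Proof.
move=> sU cU.
have mono (X Y : set N) :
  X `<=` Y -> (f @^-1` X) `&` U `<=` (f @^-1` Y) `&` U.
  by move=> XY x [/XY Yx Ux].
have sub (X : set N) : submodule X -> X `<=` f @` U ->
    submodule (f @^-1` X `&` U) /\ f @^-1` X `&` U `<=` U.
  move=> sX _; split; last by move=> x [].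
  by apply: submoduleI => //; apply: submodule_preim.
apply: (chain_cond_pull cU cU sub sub mono mono) => X Y _ _ YU _ YX _ y Yy.
have [x Ux fx] := YU y Yy.
by have [|] := YX x; rewrite /preimage /= fx.
Qed.

(* A submodule [X] of [U] is determined, among the submodules containing or
   contained in it, by [X `&` kernel f] and [f @` X]. *)
Lemma chain_cond_ext b M N (f : {linear M -> N}) (U : set M) :
  chain_cond b (kernel f `&` U) -> chain_cond b (f @` U) -> chain_cond b U.
Proof.
move=> cK cI.
apply: (chain_cond_pull cK cI (phi1 := fun X => kernel f `&` X)
                              (phi2 := fun X => f @` X)).
- move=> X sX XU; split; last by move=> x [kx /XU].
  by apply: submoduleI => //; apply: submodule_ker.
- move=> X sX XU; split; first exact: submodule_im.
  by move=> _ [x /XU Ux <-]; exists x.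
- by move=> X Y XY x [kx /XY].
- by move=> X Y XY _ [x /XY Ux <-]; exists x.
move=> X Y sX sY YU XY YX1 YX2 y Yy.
have [|x Xx fxy] := YX2 (f y); first by exists y.
rewrite -(subrK x y); apply: submoduleD => //.
have [|//] := YX1 (y - x); split.
  by rewrite /kernel /= linearB fxy subrr.
by apply: submoduleB => //; apply: XY.
Qed.

Lemma chain_cond_inj b M N (f : {linear M -> N}) (U : set M) :
  injective f -> chain_cond b (f @` U) -> chain_cond b U.
Proof.
move=> fi; apply: chain_cond_ext; apply: chain_condS (@chain_cond0 b M).
by move=> x [/(inj_kernel fi)].
Qed.

Lemma chain_cond_sum b M (U V : set M) : submodule U -> submodule V ->
  chain_cond b U -> chain_cond b V -> chain_cond b (subsum U V).
Proof.
move=> sU sV cU cV; have [Q [q [qs kq]]] := quotient_ex sU.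
apply: (@chain_cond_ext b _ _ q).
  by apply: chain_condS cU => x []; rewrite kq.
apply: chain_condS (chain_cond_im (f := q) sV cV).
move=> _ [_ [u [v [Uu Vv ->]]] <-]; exists v => //.
by have := Uu; rewrite -kq /kernel /= linearD => ->; rewrite add0r.
Qed.

Definition lin_comb n M (g : 'I_n -> M) (c : 'rV[R]_n) : M :=
  \sum_i c 0 i *: g i.

Fact lin_comb_linear n M (g : 'I_n -> M) a x y :
  lin_comb g (a *: x + y) = a *: lin_comb g x + lin_comb g y.
Proof.
rewrite /lin_comb scaler_sumr -big_split /=; apply: eq_bigr => i _.
by rewrite !mxE scalerDl scalerA.
Qed.

HB.instance Definition _ n M (g : 'I_n -> M) :=
  GRing.isLinear.Build R 'rV[R]_n M *:%R (lin_comb g) (lin_comb_linear g).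

Lemma lin_comb_in n M (g : 'I_n -> M) (U : set M) c :
  submodule U -> (forall i, U (g i)) -> U (lin_comb g c).
Proof.
by move=> sU Ug; apply: submodule_sum => // i _; apply: submoduleZ.
Qed.

Lemma lin_comb_delta n M (g : 'I_n -> M) i : lin_comb g (delta_mx 0 i) = g i.
Proof.
rewrite /lin_comb (bigD1 i) //= mxE !eqxx scale1r big1 ?addr0 // => j ji.
by rewrite mxE (negPf ji) scale0r.
Qed.

Lemma finitely_generatedP M :
  finitely_generated M <-> exists n (g : 'I_n -> M), surj (lin_comb g).
Proof.
split=> [[n [g gP]]|[n [g gs]]]; exists n, g => x.
  have [c ->] := gP x; exists (\row_i c i).
  by apply: eq_bigr => i _; rewrite mxE.
by have [c <-] := gs x; exists (c 0).
Qed.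

Lemma noetherian_generated M (U : set M) :
  submodule U -> chain_cond false U ->
  exists n (g : 'I_n -> M), range (lin_comb g) = U.
Proof.
move=> sU cU.
have [|X [sX XU [n [g gX]] mX]] :=
    cU [set X | exists n (g : 'I_n -> M), range (lin_comb g) = X].
  exists [set 0]; split; first exact: submodule_zero.
    by move=> _ ->; apply: submodule0.
  exists 0%N, (fun=> 0); apply/seteqP; split=> [_ [c _ <-]|_ ->].
    by rewrite /lin_comb big_ord0.
  by exists 0 => //; rewrite linear0.
exists n, g; rewrite gX; apply/seteqP; split=> // x Ux.
(* The generators [g] of the maximal finitely generated submodule, with [x] put in front; by
   maximality [x] was already in their span. *)
pose g' (i : 'I_n.+1) := oapp g x (unlift ord0 i).
have g'E c : lin_comb g' c = c 0 0 *: x + lin_comb g (\row_i c 0 (lift 0 i)).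
  rewrite /lin_comb big_ord_recl /g' unlift_none /=; congr (_ + _).
  by apply: eq_bigr => i _; rewrite liftK mxE.
have g'x : range (lin_comb g') x.
  exists (delta_mx 0 0) => //; rewrite lin_comb_delta.
  by rewrite /g' unlift_none.
apply: (mX (range (lin_comb g'))) => //; last 1 first.
- rewrite -gX => _ [c _ <-].
  exists (\row_i oapp (c 0) 0 (unlift ord0 i)) => //.
  rewrite g'E mxE unlift_none scale0r add0r.
  by apply: eq_bigr => i _; rewrite !mxE liftK.
- exact: (submodule_range (lin_comb g')).
- move=> _ [c _ <-]; apply: lin_comb_in => // i.
  rewrite /g'; case: (unlift _ _) => //= j; apply: XU; rewrite -gX.
  by exists (delta_mx 0 j) => //; rewrite lin_comb_delta.
by exists n.+1, g'.
Qed.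

(** [M] is a finite sum of cyclic submodules, and each of these is an image of [R^o]. *)
Lemma finitely_generated_chain_cond b M :
  chain_cond b [set: R^o] -> finitely_generated M -> chain_cond b [set: M].
Proof.
move=> cR /finitely_generatedP[n [g gs]].
have actP (x : M) a (u v : R^o) : (a *: u + v) *: x = a *: (u *: x) + v *: x.
  by rewrite scalerDl scalerA.
pose cyc x : set M := range (mklin (actP x)).
have ccyc x : chain_cond b (cyc x).
  exact: (chain_cond_im (f := mklin (actP x)) (@submoduleT R _) cR).
have scyc x : submodule (cyc x) by apply: submodule_range.
have span (s : seq 'I_n) : exists U : set M,
    [/\ submodule U, chain_cond b U & forall i, i \in s -> U (g i)].
  elim: s => [|i s [U [sU cU Us]]].
    exists [set 0]; split=> //; first exact: submodule_zero.
    exact: chain_cond0.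
  exists (subsum (cyc (g i)) U); split.
  - by apply: submodule_subsum.
  - by apply: chain_cond_sum.
  move=> j; rewrite inE => /orP[/eqP->|js].
    by apply: subsumUl => //; exists 1 => //=; rewrite scale1r.
  by apply: subsumUr => //; apply: Us.
have [U [sU cU Ug]] := span (enum 'I_n).
apply: chain_condS cU => x _; have [c <-] := gs x.
by apply: lin_comb_in => // i; apply: Ug; rewrite mem_enum.
Qed.

(** In a family without minimal member, choosing a strictly smaller member again and again yields a
    chain that never becomes stationary. *)
Lemma artinian_chain_cond M : artinian M -> chain_cond true [set: M].
Proof.
move=> aM F [X0 [sX0 _ FX0]]; apply: contrapT => noX.
pose T := {X : set M | submodule X /\ F X}.
have next (X : T) : exists Y : T,
    sval Y `<=` sval X /\ ~ sval X `<=` sval Y.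
  case: X => X [sX FX] /=; apply: contrapT => noY; apply: noX.
  exists X; split=> // Y sY _ FY /= YX; apply: contrapT => XY.
  by apply: noY; exists (exist _ Y (conj sY FY)).
have [nx nxP] := choice next.
pose U n := iter n nx (exist _ X0 (conj sX0 FX0) : T).
have [|n x|n nP] := aM (fun n => sval (U n)).
- by move=> n; case: (svalP (U n)).
- by case: (nxP (U n)) => h _; apply: h.
by case: (nxP (U n)) => _; apply; apply: (nP n.+1).
Qed.

(** The kernels of the iterates of [f] become stationary at some [n]. An element of [kernel f] has
    the form [iter n f y], and then [y] lies in the kernel of [iter n.+1 f], hence of [iter n f]. *)
Lemma surj_endo_inj M (f : {linear M -> M}) :
  chain_cond false [set: M] -> surj f -> injective f.
Proof.
move=> cM fs; have kS n : submodule (kernel (iter n f)).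
  elim: n => [|n IH]; first exact: submodule_zero.
  suff -> : kernel (iter n.+1 f) = f @^-1` kernel (iter n f).
    exact: submodule_preim.
  by apply/predeqP => x; rewrite /kernel /preimage /mkset iterSr.
have [|_ [_ _ [n ->] mX]] := cM [set X | exists n, X = kernel (iter n f)].
  by exists (kernel (iter 0 f)); split=> //; exists 0%N.
apply: kernel_inj => x fx.
have [y yx] : exists y, iter n f y = x.
  elim: (n) => [|m [y <-]]; first by exists x.
  by have [z <-] := fs y; exists z; rewrite iterSr.
rewrite -yx; apply: (mX (kernel (iter n.+1 f))) => //=.
- by exists n.+1.
- by move=> z /=; rewrite /kernel /= => ->; rewrite linear0.
by rewrite /kernel /= yx.
Qed.

(** Dual to the previous argument: the ranges of the iterates become stationary, and an iterate of
    [f] can be cancelled by injectivity. *)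
Lemma inj_endo_surj M (f : {linear M -> M}) :
  chain_cond true [set: M] -> injective f -> surj f.
Proof.
move=> cM fi; have rS n : submodule (range (iter n f)).
  elim: n => [|n IH].
    suff -> : range (iter 0 f) = setT by [].
    by apply/seteqP; split=> // x; exists x.
  suff -> : range (iter n.+1 f) = f @` range (iter n f).
    exact: submodule_im.
  apply/predeqP => x; split=> [[y _ <-]|[_ [y _ <-] <-]]; last by exists y.
  by exists (iter n f y) => //; exists y.
have [|_ [_ _ [n ->] mX]] := cM [set X | exists n, X = range (iter n f)].
  by exists (range (iter 0 f)); split=> //; exists 0%N.
have rE : range (iter n f) `<=` range (iter n.+1 f).
  apply: mX => //; first by exists n.+1.
  by move=> _ [y _ <-]; exists (f y) => //; rewrite -iterSr.
move=> x; have [|y _ fy] := rE (iter n f x); first by exists x.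
exists y; have iter_inj k : injective (iter k f).
  by elim: k => // k IH u v /= /fi /IH.
by apply: (iter_inj n); rewrite -iterSr.
Qed.

(** Both chain conditions together, which is equivalent to having a composition series. *)
Definition finite_length M := forall b, chain_cond b [set: M].

Lemma finite_length_inj M N (f : {linear M -> N}) :
  injective f -> finite_length N -> finite_length M.
Proof.
by move=> fi cN b; apply: (chain_cond_inj fi); apply: chain_condS (cN b).
Qed.

Lemma finite_length_surj M N (f : {linear M -> N}) :
  surj f -> finite_length M -> finite_length N.
Proof.
move=> fs cM b; apply: chain_condS (chain_cond_im (f := f) _ (cM b)) => //.
by move=> y _; have [x <-] := fs y; exists x.
Qed.

Lemma finite_length_generated M : finite_length M -> finitely_generated M.
Proof.
move=> /(_ false) cM; apply/finitely_generatedP.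
have [n [g gT]] := noetherian_generated (@submoduleT R M) cM.
exists n, g => x; have : [set: M] x by [].
by rewrite -gT => -[c _ cx]; exists c.
Qed.

End ChainConditions.

(** * The Hopkins theorem *)

Section Hopkins.
Variable R : nzRingType.
Implicit Types (M N Q : lmodType R).

Definition lspan M (B : set M) : set M :=
  [set x | forall X, submodule X -> B `<=` X -> X x].

Lemma submodule_lspan M (B : set M) : submodule (lspan B).
Proof.
split=> [X sX _|a x y Bx By X sX BX]; first exact: submodule0.
by case: (sX) => _; apply; [apply: Bx | apply: By].
Qed.

Lemma sub_lspan M (B : set M) : B `<=` lspan B.
Proof. by move=> x Bx X _; apply. Qed.

Lemma lspan_sub M (B U : set M) : submodule U -> B `<=` U -> lspan B `<=` U.
Proof. by move=> sU BU x; apply. Qed.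

Definition simple_sub M (V : set M) : Prop :=
  [/\ submodule V, ~ V `<=` [set 0] &
      forall W, submodule W -> W `<=` V -> W `<=` [set 0] \/ V `<=` W].

Definition socle M : set M := lspan (\bigcup_(V in @simple_sub M) V).

(** The orbit map of [m]. For [M = R^o] it is right multiplication by [m], which is linear for the
    left module structure. *)
Definition act M (m : M) (a : R^o) : M := a *: m.

Fact act_linear M (m : M) a x y : act m (a *: x + y) = a *: act m x + act m y.
Proof. by rewrite /act scalerDl scalerA. Qed.

HB.instance Definition _ M (m : M) :=
  GRing.isLinear.Build R R^o M *:%R (act m) (act_linear m).

Definition jacobson : set R^o :=
  [set x | forall S : lmodType R, simple_module S -> forall s : S, x *: s = 0].

Lemma submodule_jacobson : submodule jacobson.
Proof.
split=> [S _ s|a x y Jx Jy S simS s]; first by rewrite scale0r.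
by rewrite scalerDl -scalerA Jx // Jy // scaler0 addr0.
Qed.

Lemma jacobsonMr (x r : R) : jacobson x -> jacobson (x * r).
Proof. by move=> Jx S simS s; rewrite -scalerA Jx. Qed.

Lemma simple_annihilator_max (S : lmodType R) (s : S) (x : R) :
  simple_module S -> x *: s != 0 -> exists r, (1 - r * x) *: s = 0.
Proof.
move=> [_ simS] xs.
have [h|h] := simS (range (act (x *: s))) (submodule_range _).
  by case/eqP: xs; apply: h; exists 1 => //; rewrite /act scale1r.
have [r _ rs] := h s; exists r.
by rewrite scalerBl scale1r -scalerA -[X in X - _]rs subrr.
Qed.

(* The left ideals [L] such that every element killed by [L] lies in the socle
   are stable under intersection with the annihilator [L'] of an element of a
   simple module: if [1 = c + l] with [c] in [L] and [l] in [L'], then [m]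
   decomposes as [c *: m + l *: m], where [c *: m] lies in the module [L m],
   which is simple or zero, and [l *: m] is killed by [L]. *)
Lemma jacobson_socle M (m : M) :
  chain_cond true [set: R^o] -> (forall x, jacobson x -> x *: m = 0) ->
  socle m.
Proof.
move=> cR; pose F (L : set R^o) := forall N (n : N),
  (forall x, L x -> x *: n = 0) -> socle n.
have [|L [sL _ FL mL]] := cR F.
  exists setT; split=> // N n /(_ 1 I); rewrite scale1r => ->.
  exact: submodule0 (submodule_lspan _).
move=> Jm; apply: (FL) => x0 Lx0; apply: Jm => S simS s.
suff h : L `<=` L `&` kernel (act s) by have [] := h x0 Lx0.
have sLs : submodule (L `&` kernel (act s)).
  by apply: submoduleI => //; apply: submodule_ker.
apply: mL => //; last by move=> ? [].
have [h|] := pselect (L `<=` kernel (act s)).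
  by move=> N n Ln; apply: FL => y Ly; apply: Ln; split=> //; apply: h.
move=> /existsNP[c0 /not_implyP[Lc0 c0s]] N n Ln.
have [r rs] := simple_annihilator_max simS (introN eqP c0s).
set c := r * c0 in rs.
have Lc : L c by apply: (submoduleZ (r) sL Lc0).
have -> : n = c *: n + (1 - c) *: n by rewrite -scalerDl addrC subrK scale1r.
apply: (submoduleD (U := @socle N)); first exact: submodule_lspan.
  have [cn0|cn0] := eqVneq (c *: n) 0.
    by rewrite cn0; apply: submodule0 (submodule_lspan _).
  apply: sub_lspan; exists (act n @` L); last by exists c.
  split; first exact: submodule_im.
    by move=> h; case/eqP: cn0; apply: h; exists c.
  move=> W sW WL.
  have [XL|] := pselect (forall x, L x -> W (x *: n) -> x *: s = 0).
    by left=> w Ww; have [x Lx xw] := WL w Ww; rewrite /= -xw; apply: Ln;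
       split=> //; apply: XL => //; rewrite -[_ *: _]/(act n x) xw.
  (* Here [x *: n] is in [W] and some [t] satisfies [(1 - t * x) *: s = 0]. For [y] in [L], the
     element [y * (1 - t * x)] lies in [L] and kills [s], so it kills [n]; thus
     [y *: n = (y * t) *: (x *: n)] is in [W]. *)
  move=> /existsNP[x /not_implyP[Lx /not_implyP[Wx xs]]]; right=> _ [y Ly <-].
  have [t ts] := simple_annihilator_max simS (introN eqP xs).
  have Lz : L (y * (1 - t * x)).
    rewrite mulrBr mulr1 mulrA; apply: submoduleB => //.
    exact: (submoduleZ (y * t) sL Lx).
  have := Ln (y * (1 - t * x)); rewrite mulrBr mulr1 mulrA scalerBl.
  move=> /(_ _)/eqP; rewrite subr_eq0 => /(_ _)/eqP h.
  rewrite /act h.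
    by rewrite -scalerA; apply: submoduleZ.
  split; first by move: Lz; rewrite mulrBr mulr1 mulrA.
  rewrite /kernel /= /act; have := congr1 ( *:%R y) ts.
  by rewrite scalerA mulrBr mulr1 mulrA scaler0.
apply: FL => x Lx; rewrite scalerA; apply: Ln; split.
  rewrite mulrBr mulr1; apply: submoduleB => //.
  exact: (submoduleZ (x) sL Lc).
by rewrite /kernel /= /act -scalerA rs scaler0.
Qed.

Lemma simple_sub_noetherian M (V : set M) : simple_sub V -> chain_cond false V.
Proof.
move=> [sV nV mV] F [X [sX XV FX]].
have [[Y [sY YV FY nY]]|no] :=
    pselect (exists Y, [/\ submodule Y, Y `<=` V, F Y & ~ Y `<=` [set 0]]).
  exists Y; split=> // Z sZ ZV FZ /= YZ.
  by case: (mV Y sY YV) => // VY; apply: subset_trans VY.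
exists X; split=> // Z sZ ZV FZ /= XZ.
apply: subset_trans (_ : [set 0] `<=` X).
  by apply: contrapT => nZ; apply: no; exists Z.
by move=> _ ->; apply: submodule0.
Qed.

(* If [M] is not noetherian, no noetherian submodule [V] contains all the simple
   ones; iterating [V := V + S] gives an infinite independent family of simple
   submodules, whose tails form a strictly descending chain. *)
Lemma artinian_socle_noetherian M :
  chain_cond true [set: M] -> (forall m : M, socle m) ->
  chain_cond false [set: M].
Proof.
move=> aM sM; apply: contrapT => nM.
pose T := {V : set M | submodule V /\ chain_cond false V}.
have next (V : T) : exists S, simple_sub S /\ ~ S `<=` sval V.
  case: V => V [sV cV] /=; apply: contrapT => no; apply: nM.
  apply: chain_condS cV => x _; apply: (sM x) => // y [S simS Sy].
  by apply: contrapT => nVy; apply: no; exists S; split=> // /(_ y Sy).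
have [S SP] := choice next.
have stepP (V : T) :
    submodule (subsum (sval V) (S V)) /\
    chain_cond false (subsum (sval V) (S V)).
  have [sV cV] := svalP V; have [simS _] := SP V; have [sS _ _] := simS.
  split; first exact: submodule_subsum.
  by apply: chain_cond_sum => //; apply: simple_sub_noetherian.
pose V n : T := iter n (fun V => exist _ _ (stepP V))
  (exist _ _ (conj (submodule_zero M) (@chain_cond0 R false M))).
have sV n : submodule (sval (V n)) by case: (svalP (V n)).
have sS n : submodule (S (V n)) by case: (SP (V n)) => -[].
have VS n : sval (V n.+1) = subsum (sval (V n)) (S (V n)) by [].
have Vmono n d : sval (V n) `<=` sval (V (n + d)%N).
  elim: d => [|d IH]; first by rewrite addn0.
  by rewrite addnS VS; apply: (subset_trans IH); apply: subsumUl.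
have SV0 n : sval (V n) `&` S (V n) `<=` [set 0].
  have [[_ _ mS] nS] := SP (V n).
  have [|x []||h] := mS (sval (V n) `&` S (V n)) => //.
    exact: submoduleI.
  by case: nS => x /h[].
(* [W n] is the tail sum of the chosen simple submodules from stage [n] on, and [Z n d] the sum of
   the first [d] of them. Independence takes the form that [Z n d] meets [V n] only in zero. *)
pose W n := lspan (\bigcup_(i in [set i | (n <= i)%N]) S (V i)).
pose Z n d := iteri d (fun i Y => subsum Y (S (V (n + i)%N))) [set 0].
have sZ n d : submodule (Z n d).
  elim: d => [|d IH]; first exact: submodule_zero.
  exact: submodule_subsum.
have ZV n d : Z n d `<=` sval (V (n + d)%N).
  elim: d => [|d IH]; first by move=> _ ->; apply: submodule0.
  rewrite addnS VS; exact: subsumS.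
have ZV0 n d : Z n d `&` sval (V n) `<=` [set 0].
  elim: d => [|d IH] x [] //= [z [s [Zz Ss ->]]] Vx.
  have s0 : s = 0.
    apply: (SV0 (n + d)%N); split=> //; rewrite -(addKr z s).
    apply: submoduleD => //; last exact: Vmono Vx.
    by apply: submoduleN => //; apply: ZV.
  by move: Vx; rewrite s0 addr0 => Vx; apply: IH.
have Zmono n d e : Z n d `<=` Z n (d + e)%N.
  elim: e => [|e IH]; first by rewrite addn0.
  by rewrite addnS; apply: (subset_trans IH); apply: subsumUl.
have WZ n : W n `<=` \bigcup_d Z n d.
  apply: lspan_sub; first split; first by exists 0%N.
    move=> a x y [d _ Zx] [e _ Zy]; exists (d + e)%N => //.
    case: (sZ n (d + e)%N) => _; apply; first exact: Zmono.
    by rewrite addnC; apply: Zmono.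
  move=> x [i /= ni Six]; exists (i - n).+1 => //=.
  by rewrite subnKC //; apply: subsumUr.
have [|_ [_ _ [n ->] mW]] := aM [set X | exists n, X = W n].
  by exists (W 0%N); split=> //; [apply: submodule_lspan | exists 0%N].
have WW : W n `<=` W n.+1.
  apply: mW => //; [exact: submodule_lspan | by exists n.+1 |].
  apply: lspan_sub; first exact: submodule_lspan.
  move=> x [i /= ni Six]; apply: sub_lspan; exists i => //=.
  exact: ltnW.
have [[_ nS _] _] := SP (V n); apply: nS => x Sx.
have [|d _ Zx] := WZ n.+1 x.
  by apply: WW; apply: sub_lspan; exists n => /=.
by apply: (ZV0 n.+1 d); split=> //; rewrite VS; apply: subsumUr.
Qed.

Fixpoint jacobson_pow n : set R^o :=
  if n is n'.+1 then
    lspan [set x | exists u j, [/\ jacobson_pow n' u, jacobson j & x = u * j]]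
  else setT.

Lemma submodule_jacobson_pow n : submodule (jacobson_pow n).
Proof. by case: n => [|n] //; apply: submodule_lspan. Qed.

Lemma jacobson_powMr n (x r : R) : jacobson_pow n x -> jacobson_pow n (x * r).
Proof.
case: n => [//|n] Jx.
suff : (act (r : R^o) @^-1` jacobson_pow n.+1) x by [].
apply: Jx; first exact: (submodule_preim _ (submodule_jacobson_pow n.+1)).
move=> _ [u [j [Ju Jj ->]]]; apply: sub_lspan; exists u, (j * r).
by split=> //; [apply: jacobsonMr | rewrite /act -[_ *: _]/(_ * _) mulrA].
Qed.

Lemma jacobson_powS n : jacobson_pow n.+1 `<=` jacobson_pow n.
Proof.
apply: lspan_sub; first exact: submodule_jacobson_pow.
by move=> _ [u [j [Ju _ ->]]]; apply: jacobson_powMr.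
Qed.

(** The powers are built by multiplying by [jacobson] on the right. Multiplication on the left is
    what shows that the radical kills each layer of the filtration of [R^o] by these powers. *)
Lemma jacobsonMpow n (j x : R) :
  jacobson j -> jacobson_pow n x -> jacobson_pow n.+1 (j * x).
Proof.
elim: n j x => [|n IH] j x Jj Jx.
  apply: sub_lspan; exists 1, (j * x); split; rewrite ?mul1r //.
  exact: jacobsonMr.
suff h : forall j, jacobson j -> jacobson_pow n.+2 (j * x) by apply: h.
apply: (Jx [set y | forall j, jacobson j -> jacobson_pow n.+2 (j * y)]).
  split=> [j' _|a y z Jy Jz j' Jj'].
    by rewrite mulr0; apply: submodule0 (submodule_jacobson_pow n.+2).
  rewrite mulrDr; apply: (submoduleD (submodule_jacobson_pow n.+2)).
    by rewrite -[a *: y]/(a * y) mulrA; apply: Jy; apply: jacobsonMr.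
  exact: Jz.
move=> _ [u [i [Ju Ji ->]]] j' Jj'; apply: sub_lspan; exists (j' * u), i.
by split=> //; [apply: IH | rewrite mulrA].
Qed.

Lemma jacobson_nilpotent :
  chain_cond true [set: R^o] -> exists n, jacobson_pow n `<=` [set 0].
Proof.
move=> cR; have [|_ [_ _ [n ->] mE]] :=
    cR [set X | exists n, X = jacobson_pow n].
  by exists setT; split=> //; exists 0%N.
exists n; set E := jacobson_pow n in mE *.
have EJ : E `<=` jacobson_pow n.+1.
  apply: mE => //; [exact: submodule_jacobson_pow | by exists n.+1 |].
  exact: jacobson_powS.
have {mE}sE : submodule E by apply: submodule_jacobson_pow.
apply: contrapT => /existsNP[e0 /not_implyP[Ee0 e0n0]].
(* [F X] says that the stationary power [E] does not annihilate [X]; a minimal such left ideal is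
   taken. *)
pose F (X : set R^o) := exists e x, [/\ E e, X x & e * x <> 0].
have [|X [sX _ [e [x [Ee Xx ex]]] mX]] := cR F.
  by exists setT; split=> //; exists e0, 1; split=> //; rewrite mulr1.
have JXX : act (x : R^o) @` jacobson `<=` X.
  by move=> _ [j _ <-]; apply: submoduleZ.
(* Since [E] is spanned by products of elements of [E] and [jacobson], it does not annihilate the
   left ideal [jacobson * x]. Minimality of [X] then puts [x] in that ideal. *)
have [j Jj jx] : (act (x : R^o) @` jacobson) x.
  apply: (mX (act (x : R^o) @` jacobson)) => //.
    exact/submodule_im/submodule_jacobson.
  apply: contrapT => no; apply: ex; rewrite -[e * x]/(act (x : R^o) e).
  apply: (EJ _ Ee (kernel _)); first exact: submodule_ker.
  move=> _ [u [j [Eu Jj ->]]]; apply: contrapT => ujx; apply: no.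
  exists u, (j * x); split=> //; first by exists j.
  by rewrite mulrA.
(* [Y] is the part of [X] annihilated by [E]. By minimality of [X] the quotient of [X] by [Y] is
   simple, so [j] kills it, and [x = j * x] falls into [Y] although [e * x] is nonzero. *)
pose Y : set R^o := [set y | X y /\ forall e, E e -> e * y = 0].
have sY : submodule Y.
  split=> [|a y z [Xy Ey] [Xz Ez]].
    by split=> [|? ?]; rewrite ?mulr0 //; apply: submodule0.
  split=> [|f Ef]; first by case: sX => _; apply.
  rewrite mulrDr Ez // -[a *: y]/(a * y) mulrA Ey ?addr0 //.
  exact: jacobson_powMr.
have [N [i [ii iX]]] := submodule_ex sX.
have [Q [q [qs kq]]] := quotient_ex (submodule_preim i sY).
have [x' _ ix'] : range i x by rewrite iX.
have qY z : q z = 0 <-> Y (i z).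
  by have := congr1 (fun U => U z) kq; rewrite /kernel /preimage /= => ->.
have nYx : ~ Y x by move=> [_ /(_ e Ee)].
have simQ : simple_module Q.
  split=> [Q0|Z sZ]; first by apply: nYx; rewrite -ix'; apply/qY.
  pose X' := i @` (q @^-1` Z).
  have sX' : submodule X' by apply: submodule_im; apply: submodule_preim.
  have X'X : X' `<=` X by rewrite -iX; apply: image_subset.
  have [FX'|nF] := pselect (F X').
    right=> z; have [w <-] := qs z; have : X (i w) by rewrite -iX; exists w.
    by move=> /(mX _ sX' _ FX' X'X)[//|w' Zw' /ii <-].
  left=> z Zz; have [w wz] := qs z; rewrite -wz; apply/qY; split.
    by rewrite -iX; exists w.
  move=> f Ef; apply: contrapT => fw; apply: nF; exists f, (i w); split=> //.
  by exists w => //; rewrite /preimage /= wz.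
apply: nYx; rewrite -ix'; apply/qY.
have -> : x' = j *: x' by apply: ii; rewrite linearZ ix'; apply: esym jx.
by rewrite linearZ; apply: Jj.
Qed.

(** Downward induction along the powers of the radical, starting from a zero power: each layer is
    artinian and killed by the radical, hence equal to its socle and noetherian. *)
Theorem artinian_noetherian_ring :
  chain_cond true [set: R^o] -> chain_cond false [set: R^o].
Proof.
move=> cR; have [n En] := jacobson_nilpotent cR.
suff step k : chain_cond false (jacobson_pow k.+1) ->
    chain_cond false (jacobson_pow k).
  have : chain_cond false (jacobson_pow n).
    exact: chain_condS (@chain_cond0 _ _ _).
  by elim: (n) => // m IH /step/IH.
move=> cE; have [Q [q [qs kq]]] := quotient_ex (submodule_jacobson_pow k.+1).
apply: (@chain_cond_ext _ _ _ _ q).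
  by apply: chain_condS cE => x []; rewrite kq.
have sU := submodule_jacobson_pow k.
have [N [i [ii iU]]] := submodule_ex (submodule_im q sU).
have cq : chain_cond true (q @` jacobson_pow k).
  by apply: chain_cond_im => //; apply: chain_condS cR.
rewrite -iU; apply: chain_cond_im => //; apply: artinian_socle_noetherian.
  by apply: (chain_cond_inj ii); rewrite iU.
move=> y; apply: jacobson_socle => // j Jj; apply: ii; rewrite linearZ linear0.
have [x Ux <-] : (q @` jacobson_pow k) (i y) by rewrite -iU; exists y.
rewrite -linearZ; have := jacobsonMpow Jj Ux.
by rewrite -kq.
Qed.

End Hopkins.

(** * Projective modules *)

Section Projectives.
Variable R : nzRingType.
Implicit Types (M N P Q K L : lmodType R).

Lemma projective_retract N P (i : {linear N -> P}) (r : {linear P -> N}) :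
  (forall x, r (i x) = x) -> projective P -> projective N.
Proof.
move=> rK pP M Q g f gs; have [h hP] := pP M Q g (f \o r) gs.
by exists (h \o i) => x /=; rewrite hP /= rK.
Qed.

Lemma projective_isomorphic N P :
  isomorphic N P -> projective P -> projective N.
Proof.
move=> iNP; have [f [g fK gK]] := iNP.
have gP a x y : g (a *: x + y) = a *: g x + g y.
  by apply: (can_inj fK); rewrite linearP !gK.
exact: (projective_retract (i := f) (r := mklin gP) fK).
Qed.

Fact inl_linear N P a (x y : N) :
  (a *: x + y, 0 : P) = a *: (x, 0) + (y, 0) :> N * P.
Proof. by congr (_, _); rewrite /= scaler0 addr0. Qed.

Fact inr_linear N P a (x y : P) :
  (0 : N, a *: x + y) = a *: (0, x) + (0, y) :> N * P.
Proof. by congr (_, _); rewrite /= scaler0 addr0. Qed.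

Lemma projective_prod N P :
  projective N -> projective P -> projective (N * P)%type.
Proof.
move=> pN pP M Q g f gs.
have [h hP] := pN M Q g (f \o mklin (@inl_linear N P)) gs.
have [k kP] := pP M Q g (f \o mklin (@inr_linear N P)) gs.
have lP a x y : h (a *: x + y).1 + k (a *: x + y).2
    = a *: (h x.1 + k x.2) + (h y.1 + k y.2).
  by rewrite !linearP scalerDr addrACA.
exists (mklin lP) => -[x y] /=; rewrite linearD hP kP /= -linearD.
by congr (f (_, _)); rewrite /= ?addr0 ?add0r.
Qed.

Lemma projective_factorl N P : projective (N * P)%type -> projective N.
Proof.
by apply: (projective_retract (i := mklin (@inl_linear N P))
            (r := (fst : {linear (N * P)%type -> N}))).
Qed.

Lemma projective_rV n : projective 'rV[R]_n.
Proof.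
move=> M N g f gs; have [s sK] := choice gs.
exists (lin_comb (fun i => s (f (delta_mx 0 i)))) => x.
rewrite /lin_comb linear_sum {2}(row_sum_delta x) linear_sum.
by apply: eq_bigr => i _; rewrite !linearZ sK.
Qed.

Lemma projective_regular : projective R^o.
Proof.
move=> M N g f gs; have [m gm] := gs (f 1); exists (act m) => x.
by rewrite /act linearZ /= gm -linearZ; congr (f _); apply: mulr1.
Qed.

Lemma projective_split M P (g : {linear M -> P}) :
  projective P -> surj g -> exists s : {linear P -> M}, forall x, g (s x) = x.
Proof. by move=> pP gs; have [s sP] := pP M P g idfun gs; exists s. Qed.

Lemma projective_generated_retract P :
  projective P -> finitely_generated P ->
  exists n (r : {linear 'rV[R]_n -> P}) (s : {linear P -> 'rV[R]_n}),
    forall x, r (s x) = x.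
Proof.
move=> pP /finitely_generatedP[n [g gs]].
by have [s sP] := projective_split pP gs; exists n, (lin_comb g), s.
Qed.

Definition projective_sub M (U : set M) : Prop :=
  exists (N : lmodType R) (i : {linear N -> M}),
    [/\ injective i, range i = U & projective N].

(** Two embeddings with the same range factor through each other, so projectivity of a submodule
    does not depend on the embedding. *)
Lemma projective_subP M (U : set M) N (i : {linear N -> M}) :
  injective i -> range i = U -> projective_sub U -> projective N.
Proof.
move=> ii iU [P [j [ji jU pP]]].
have [s sP] : exists s : {linear N -> P}, forall x, j (s x) = i x.
  by apply: lift_ex => //; rewrite iU jU.
have [r rP] : exists r : {linear P -> N}, forall x, i (r x) = j x.
  by apply: lift_ex => //; rewrite iU jU.
apply: (projective_retract (i := s) (r := r)) pP => x.
by apply: ii; rewrite rP sP.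
Qed.

Definition kernels_projective : Prop :=
  forall (N P : lmodType R) (f : {linear N -> P}),
    projective N -> finitely_generated N ->
    projective P -> finitely_generated P -> projective_sub (kernel f).

Lemma schanuel M P P' K K' (e : {linear P -> M}) (e' : {linear P' -> M})
    (i : {linear K -> P}) (i' : {linear K' -> P'}) :
  projective P -> projective P' -> surj e -> surj e' ->
  injective i -> injective i' -> range i = kernel e -> range i' = kernel e' ->
  isomorphic (K * P')%type (K' * P)%type.
Proof.
move=> pP pP' es es' ii ii' iE iE'.
have [h hP] := pP _ _ e' e es'; have [h' hP'] := pP' _ _ e e' es.
have ei k : e (i k) = 0 by have : kernel e (i k) by rewrite -iE; exists k.
have ei' k : e' (i' k) = 0 by have : kernel e' (i' k) by rewrite -iE'; exists k.
(* The isomorphism sends [(k, y)] to [(v, u)] with [u = i k - h' y] and [i' v = y + h u], an element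
   of [kernel e']. Its inverse is given by the same formulas with the two presentations
   exchanged. *)
have uP a (x y : K * P') : i (a *: x + y).1 - h' (a *: x + y).2 =
    a *: (i x.1 - h' x.2) + (i y.1 - h' y.2).
  by rewrite !linearP scalerBr addrACA scalerN.
pose u := mklin uP.
have uP' a (x y : K' * P) : i' (a *: x + y).1 - h (a *: x + y).2 =
    a *: (i' x.1 - h x.2) + (i' y.1 - h y.2).
  by rewrite !linearP scalerBr addrACA scalerN.
pose u' := mklin uP'.
have wP a (x y : K * P') : (a *: x + y).2 + h (u (a *: x + y)) =
    a *: (x.2 + h (u x)) + (y.2 + h (u y)).
  by rewrite !linearP scalerDr addrACA.
have wP' a (x y : K' * P) : (a *: x + y).2 + h' (u' (a *: x + y)) =
    a *: (x.2 + h' (u' x)) + (y.2 + h' (u' y)).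
  by rewrite !linearP scalerDr addrACA.
have [v vP] : exists v : {linear (K * P')%type -> K'}, forall x,
    i' (v x) = mklin wP x.
  apply: lift_ex => //; rewrite iE' => _ [x _ <-]; rewrite /kernel /=.
  by rewrite linearD hP linearB ei sub0r hP' subrr.
have [v' vP'] : exists v : {linear (K' * P)%type -> K}, forall x,
    i (v x) = mklin wP' x.
  apply: lift_ex => //; rewrite iE => _ [x _ <-]; rewrite /kernel /=.
  by rewrite linearD hP' linearB ei' sub0r hP subrr.
have fP a x y : (v (a *: x + y), u (a *: x + y)) = a *: (v x, u x) + (v y, u y).
  by rewrite !linearP.
exists (mklin fP); exists (fun x => (v' x, u' x)) => [[k y]|[k x]] /=.
  congr (_, _); last by rewrite vP /= addrK.
  by apply: ii; rewrite vP' /= vP /= addrK subrK.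
congr (_, _); last by rewrite vP' /= addrK.
by apply: ii'; rewrite vP /= vP' /= addrK subrK.
Qed.

Lemma quotient_generated M N (q : {linear M -> N}) :
  surj q -> finitely_generated M -> finitely_generated N.
Proof.
move=> qs /finitely_generatedP[n [g gs]]; apply/finitely_generatedP.
exists n, (q \o g) => y; have [x <-] := qs y; have [c <-] := gs x.
by exists c; rewrite linear_sum; apply: eq_bigr => i _; rewrite linearZ.
Qed.

Lemma range_factor M N (f : {linear M -> N}) :
  exists (L : lmodType R) (g : {linear M -> L}) (l : {linear L -> N}),
    [/\ surj g, injective l & forall x, l (g x) = f x].
Proof.
have [L [l [li lf]]] := submodule_ex (submodule_range f).
have [g gP] : exists g : {linear M -> L}, forall x, l (g x) = f x.
  by apply: lift_ex => //; rewrite lf.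
exists L, g, l; split=> // y; have : range f (l y) by rewrite -lf; exists y.
by move=> [x _ xy]; exists x; apply: li; rewrite gP.
Qed.

(* Schanuel's lemma, once on the images [L], [L'] of the first differentials and
   once on their kernels. *)
Lemma gl_dim2_kernels_projective : gl_dim_le R 2 -> kernels_projective.
Proof.
move=> gl2 N1 N2 f pN1 _ pN2 fgN2.
have [M [pi [pis kpi]]] := quotient_ex (submodule_range f).
have [P [d [e [pP es de dd P0]]]] := gl2 M (quotient_generated pis fgN2).
have [pP0 _] := pP 0%N; have [pP1 _] := pP 1%N; have [pP2 _] := pP 2%N.
have [K [i [ii iK]]] := submodule_ex (submodule_ker f).
exists K, i; split=> //.
have [L [g [l [gs li lg]]]] := range_factor f.
have [L' [g' [l' [gs' li' lg']]]] := range_factor (d 0%N).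
have [th [th' thK thK']] : isomorphic (L * P 0%N)%type (L' * N2)%type.
  apply: (schanuel (e := pi) (e' := e) (i := l) (i' := l')) => //.
    rewrite kpi; apply/seteqP; split=> [_ [y _ <-]|_ [x _ <-]].
      by have [x <-] := gs y; exists x.
    by exists (g x).
  apply/seteqP; split=> [_ [y _ <-]|x /de[y <-]]; last by exists (g' y).
  by have [x <-] := gs' y; apply/de; exists x.
have EP a (x y : N1 * P 0%N) : th (g (a *: x + y).1, (a *: x + y).2) =
    a *: th (g x.1, x.2) + th (g y.1, y.2).
  by rewrite -linearP; congr (th (_, _)); rewrite /= linearP.
have EP' a (x y : P 1%N * N2) : (g' (a *: x + y).1, (a *: x + y).2) =
    a *: (g' x.1, x.2) + (g' y.1, y.2).
  by congr (_, _); rewrite /= linearP.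
have iKP a (x y : K) : (i (a *: x + y), 0 : P 0%N) = a *: (i x, 0) + (i y, 0).
  by congr (_, _); rewrite /= ?linearP ?scaler0 ?addr0.
have iKP' a x y : (d 1%N (a *: x + y), 0 : N2) =
    a *: (d 1%N x, 0) + (d 1%N y, 0).
  by congr (_, _); rewrite /= ?linearP ?scaler0 ?addr0.
(* This is where dimension 2 enters: [P 3] is zero, so [d 1] embeds [P 2] as the kernel of [d 0]. *)
have d1i : injective (d 1%N).
  apply: kernel_inj => x /(dd 1%N)[y <-] /=.
  by rewrite (P0 3 isT y) linear0.
have : isomorphic (K * (P 1%N * N2))%type (P 2 * (N1 * P 0%N))%type.
  apply: (schanuel (e := mklin EP) (e' := mklin EP')
            (i := mklin iKP) (i' := mklin iKP')) => //=.
  - exact: projective_prod.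
  - exact: projective_prod.
  - move=> y; have [x xy] := gs (th' y).1; exists (x, (th' y).2) => /=.
    by rewrite xy -surjective_pairing thK'.
  - by move=> [y z]; have [x xy] := gs' y; exists (x, z); rewrite /= xy.
  - by move=> x y [/ii].
  - by move=> x y [/d1i].
  - apply/seteqP; split=> [_ [k _ <-]|[x y]]; rewrite /kernel /=.
      have : kernel f (i k) by rewrite -iK; exists k.
      rewrite /kernel /= -lg => /(inj_kernel li) ->.
      by rewrite (linear0 th : th (0, 0) = 0).
    move=> thx; have [gx ->] : (g x, y) = (0, 0).
      by apply: (can_inj thK); rewrite thx (linear0 th : th (0, 0) = 0).
    have : kernel f x by rewrite /kernel /= -lg gx linear0.
    by rewrite -iK => -[k _ <-]; exists k.
  apply/seteqP; split=> [_ [k _ <-]|[x y]]; rewrite /kernel /=.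
    congr (_, _); apply: li'; rewrite lg' linear0.
    by apply/(dd 0%N); exists k.
  move=> [gx ->]; have : d 0%N x = 0 by rewrite -lg' gx linear0.
  by move=> /(dd 0%N)[k <-]; exists k.
move=> iso; apply: (@projective_factorl K (P 1%N * N2)%type).
by apply: (projective_isomorphic iso); do 2?apply: projective_prod.
Qed.

Lemma finite_length_of_generated M :
  finite_length R^o -> finitely_generated M -> finite_length M.
Proof. by move=> cR fg b; apply: finitely_generated_chain_cond. Qed.

Lemma finite_length_rV n : finite_length R^o -> finite_length 'rV[R]_n.
Proof.
move=> cR; apply: finite_length_of_generated => //; apply/finitely_generatedP.
exists n, (fun i => delta_mx 0 i) => x; exists x.
by rewrite [RHS]row_sum_delta.
Qed.

Lemma row_kernel_generated p q (G : 'M[R]_(p, q)) :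
  finite_length R^o ->
  exists s (n : 'M[R]_(s, p)), n *m G = 0 /\
    forall m (x : 'M[R]_(m, p)), x *m G = 0 -> exists c, x = c *m n.
Proof.
move=> cR; have GP a (x y : 'rV[R]_p) :
    (a *: x + y) *m G = a *: (x *m G) + y *m G.
  by rewrite mulmxDl scalemxAl.
have [|s [g gG]] := noetherian_generated (submodule_ker (mklin GP)).
  by apply: chain_condS (finite_length_rV cR false).
pose n := \matrix_i g i.
have nE c : c *m n = lin_comb g c.
  by rewrite mulmx_sum_row; apply: eq_bigr => i _; rewrite rowK.
exists s, n; split=> [|m x xG].
  apply/row_matrixP => i; rewrite row_mul rowK row0.
  suff : kernel (mklin GP) (g i) by [].
  by rewrite -gG; exists (delta_mx 0 i) => //; rewrite lin_comb_delta.
have /choice[c cP] : forall i, exists c, lin_comb g c = row i x.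
  move=> i; have : kernel (mklin GP) (row i x).
    by rewrite /kernel /= -row_mul xG row0.
  by rewrite -gG => -[c _ cx]; exists c.
exists (\matrix_i c i); apply/row_matrixP => i.
by rewrite row_mul rowK nE cP.
Qed.

End Projectives.

(** * Passing to the converse ring *)

Section Converse.
Variable R : nzRingType.

(** Transposition reverses products between [R^c] and [R], so a right kernel over one ring becomes a
    left kernel, that is a kernel of row vectors, over the other. *)
Let tr m n (X : 'M[R^c]_(m, n)) : 'M[R]_(n, m) := X^T.
Let untr m n (X : 'M[R]_(m, n)) : 'M[R^c]_(n, m) := X^T.

Let untrM m n p (X : 'M[R]_(m, n)) (Y : 'M[R]_(n, p)) :
  untr (X *m Y) = untr Y *m untr X.
Proof. by apply/matrixP=> k i /[!mxE]; apply: eq_bigr => j _ /[!mxE]. Qed.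

Let trM m n p (X : 'M[R^c]_(m, n)) (Y : 'M[R^c]_(n, p)) :
  tr (X *m Y) = tr Y *m tr X.
Proof. by apply/matrixP=> k i /[!mxE]; apply: eq_bigr => j _ /[!mxE]. Qed.

Let trK m n (X : 'M[R^c]_(m, n)) : untr (tr X) = X.
Proof. exact: trmxK. Qed.

Let tr0 m n : tr (0 : 'M[R^c]_(m, n)) = 0.
Proof. exact: trmx0. Qed.

Lemma mul_rV_linear m n (f : {linear 'rV[R]_m -> 'rV[R]_n}) :
  exists F : 'M[R]_(m, n), forall x, x *m F = f x.
Proof. by exists (lin1_mx f) => x; rewrite mul_rV_lin1. Qed.

(* The rows of [n] generate the left kernel of [G], those of [a] the relations
   between them. Over the converse ring the kernel of [a] is projective, so that
   [n] factors as [B *m m] with [a *m B = 0] and [m *m G = 0]; then [m = C *m n]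
   and [E := B *m C] is an idempotent presenting the left kernel of [G] as a
   direct summand of a free module. *)
Lemma conv_kernel_idempotent p q (G : 'M[R^c]_(p, q)) :
  finite_length R^o -> finite_length (R^c)^o -> kernels_projective R ->
  exists s (n : 'M[R^c]_(s, p)) (E : 'M[R^c]_s),
    [/\ n *m G = 0,
        forall (x : 'rV[R^c]_p), x *m G = 0 -> exists c, x = c *m n,
        forall (c : 'rV[R^c]_s), c *m n = 0 -> c *m E = 0
      & E *m n = n].
Proof.
move=> cR cRc kR.
have [s [n [nG gen]]] := row_kernel_generated G cRc.
have [t [a [an rel]]] := row_kernel_generated n cRc.
have aP c (x y : 'rV[R]_s) :
    (c *: x + y) *m tr a = c *: (x *m tr a) + y *m tr a.
  by rewrite mulmxDl scalemxAl.
have fgV k : finitely_generated 'rV[R]_k.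
  exact/finite_length_generated/finite_length_rV.
have [K [i [ii iK pK]]] := kR _ _ (mklin aP) (projective_rV (n := s)) (fgV s)
  (projective_rV (n := t)) (fgV t).
have fgK : finitely_generated K.
  exact/finite_length_generated/(finite_length_inj ii)/finite_length_rV.
have [r [u [v uv]]] := projective_generated_retract pK fgK.
have nP c (x y : 'rV[R]_p) :
    (c *: x + y) *m tr n = c *: (x *m tr n) + y *m tr n.
  by rewrite mulmxDl scalemxAl.
have [w wP] : exists w : {linear 'rV[R]_p -> K}, forall x, i (w x) = mklin nP x.
  apply: lift_ex => //; rewrite iK => _ [x _ <-].
  by rewrite /kernel /= -mulmxA -trM an tr0 mulmx0.
have [B BP] := mul_rV_linear (i \o u).
have [m mP] := mul_rV_linear (v \o w).
have aB : a *m untr B = 0.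
  rewrite -(trK a) -untrM; suff -> : B *m tr a = 0 by apply: trmx0.
  apply/row_matrixP => j; rewrite row0 rowE mulmxA BP.
  suff : kernel (mklin aP) ((i \o u) (delta_mx 0 j)) by [].
  by rewrite -iK; exists (u (delta_mx 0 j)).
have mG : untr m *m G = 0.
  rewrite -(trK G) -untrM; suff -> : tr G *m m = 0 by apply: trmx0.
  apply/row_matrixP => j; rewrite row0 rowE mulmxA mP /=.
  suff -> : w (delta_mx 0 j *m tr G) = 0 by rewrite linear0.
  by apply: ii; rewrite wP /= -mulmxA -trM nG tr0 mulmx0 linear0.
have nE : n = untr B *m untr m.
  rewrite -untrM -[n in LHS]trK; congr (untr _).
  by apply/row_matrixP => j; rewrite !rowE mulmxA mP BP /= uv wP.
have [C CP] := gen _ _ mG.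
exists s, n, (untr B *m C); split=> //; first exact: gen.
  by move=> c /rel[d ->]; rewrite -mulmxA [a *m _]mulmxA aB mul0mx mulmx0.
by rewrite -mulmxA -CP -nE.
Qed.

Lemma kernels_projective_conv :
  finite_length R^o -> finite_length (R^c)^o -> kernels_projective R ->
  kernels_projective R^c.
Proof.
move=> cR cRc kR N1 N2 f p1 fg1 p2 fg2.
have [k1 [r1 [s1 rs1]]] := projective_generated_retract p1 fg1.
have [k2 [r2 [s2 rs2]]] := projective_generated_retract p2 fg2.
(* The matrix of [f] carried over to the free modules of which [N1] and [N2] are retracts. *)
pose G := lin1_mx (s2 \o f \o r1).
have GE x : x *m G = s2 (f (r1 x)) by rewrite mul_rV_lin1.
have [s [n [E [nG gen rel En]]]] := conv_kernel_idempotent G cR cRc kR.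
have [K [i [ii iK]]] := submodule_ex (submodule_ker f).
exists K, i; split=> //.
have s2i : injective s2 by apply: can_inj rs2.
have /choice[c cP] : forall x, exists c, s1 (i x) = c *m n.
  move=> x; apply: gen; rewrite GE rs1.
  have : kernel f (i x) by rewrite -iK; exists x.
  by move=> ->; rewrite linear0.
(* The chosen coefficients [c] need not be linear, but the defect is a relation between the rows of
   [n], which [E] kills. Multiplying by [E] thus gives a linear map. *)
have cEP a x y : c (a *: x + y) *m E = a *: (c x *m E) + c y *m E.
  apply/eqP; rewrite -subr_eq0 scalemxAl -mulmxDl -mulmxBl; apply/eqP/rel.
  rewrite mulmxBl mulmxDl -scalemxAl -!cP.
  by rewrite [i (_ + _)]linearP [s1 (_ + _)]linearP subrr.
have rP a x y : r1 ((a *: x + y) *m n) = a *: r1 (x *m n) + r1 (y *m n).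
  by rewrite mulmxDl -scalemxAl linearP.
have [r rE] : exists r : {linear 'rV[R^c]_s -> K}, forall x,
    i (r x) = mklin rP x.
  apply: lift_ex => //; rewrite iK => _ [x _ <-]; rewrite /kernel /=.
  by apply: s2i; rewrite -GE -mulmxA nG mulmx0 linear0.
apply: (projective_retract (i := mklin cEP) (r := r)) (projective_rV (n := s)).
by move=> x; apply: ii; rewrite rE /= -mulmxA En -cP rs1.
Qed.

End Converse.

(** * Simple modules and projective covers *)

Section Simples.
Variable R : nzRingType.
Implicit Types (M N P Q S X : lmodType R).

Lemma nonzero_simple_surj M S (f : {linear M -> S}) :
  simple_module S -> (exists x, f x <> 0) -> surj f.
Proof.
move=> [_ sS] [x fx]; have [h|h] := sS _ (submodule_range f).
  by case: fx; apply: h; exists x.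
by move=> y; have [z _ <-] := h y; exists z.
Qed.

Lemma simple_isomorphic M S (f : {linear M -> S}) :
  simple_module M -> simple_module S -> (exists x, f x <> 0) -> isomorphic M S.
Proof.
move=> [_ sM] simS fn0; apply: (@bij_isomorphic _ _ _ f).
  apply: kernel_inj; have [//|kT] := sM _ (submodule_ker f).
  by have [x fx] := fn0; case: fx; apply: kT.
exact: nonzero_simple_surj.
Qed.

(** A minimal submodule strictly above [U]; it supplies the next simple layer when a series is built
    from the bottom. *)
Lemma submodule_cover M (U : set M) :
  chain_cond true [set: M] -> submodule U -> ~ [set: M] `<=` U ->
  exists V, [/\ submodule V, U `<=` V, ~ V `<=` U &
    forall W, submodule W -> U `<=` W -> W `<=` V -> W `<=` U \/ V `<=` W].
Proof.
move=> cM sU nU; have [|V [sV _ [UV nV] mV]] :=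
    cM [set V | U `<=` V /\ ~ V `<=` U].
  by exists setT; split=> //; split=> //; apply: subsetT.
exists V; split=> // W sW UW WV.
have [|nW] := pselect (W `<=` U); [by left | right].
exact: mV.
Qed.

Lemma maximal_submodule M (U : set M) :
  chain_cond false [set: M] -> submodule U -> ~ [set: M] `<=` U ->
  exists V, [/\ submodule V, U `<=` V, ~ [set: M] `<=` V &
    forall W, submodule W -> V `<=` W -> W `<=` V \/ [set: M] `<=` W].
Proof.
move=> cM sU nU; have [|V [sV _ [UV nV] mV]] :=
    cM [set V | U `<=` V /\ ~ [set: M] `<=` V].
  by exists U; split=> //; split.
exists V; split=> // W sW VW.
have [|nW] := pselect ([set: M] `<=` W); [by right | left].
apply: (mV W sW) => //; split=> //; exact: subset_trans VW.
Qed.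

Lemma simple_quotient M (U : set M) :
  chain_cond false [set: M] -> submodule U -> ~ [set: M] `<=` U ->
  exists (S : lmodType R) (f : {linear M -> S}),
    [/\ simple_module S, surj f & U `<=` kernel f].
Proof.
move=> cM sU nU; have [V [sV UV nV mV]] := maximal_submodule cM sU nU.
have [S [f [fs kf]]] := quotient_ex sV; exists S, f.
split=> //; last by rewrite kf.
split=> [S0|W sW]; first by apply: nV => x _; rewrite -kf; apply: S0.
have [|h|h] := mV _ (submodule_preim f sW).
- by rewrite -kf => x; rewrite /kernel /preimage /= => ->; apply: submodule0.
- left=> y Wy; have [x xy] := fs y; rewrite -xy.
  by have := h x; rewrite -kf; apply; rewrite /preimage /= xy.
by right=> y; have [x <-] := fs y; apply: h.
Qed.

Lemma subquotient_isoI M N X (U V : set M) (i : {linear N -> M})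
    (q : {linear N -> X}) :
  injective i -> range i = U -> surj q -> (forall x, q x = 0 <-> V (i x)) ->
  subquotient_iso U V X.
Proof.
move=> ii <- qs qV.
(* [subquotient_iso] asks for a function on all of [M]; outside the range of [i] it takes the value
   0. *)
have /choice[f fE] : forall x, exists z, forall y, i y = x -> z = q y.
  move=> x; have [[y yx]|no] := pselect (exists y, i y = x).
    by exists (q y) => y'; rewrite -yx => /ii ->.
  by exists 0 => y yx; case: no; exists y.
have fi y : f (i y) = q y by apply: fE.
exists f; split=> [a _ _ [x _ <-] [y _ <-]|z|_ [x _ <-]].
- by rewrite -linearP !fi linearP.
- by have [y <-] := qs z; exists (i y) => //; exists y.
by rewrite fi.
Qed.

Lemma simple_subquotient M (U V : set M) :
  submodule U -> submodule V -> U `<=` V -> ~ V `<=` U ->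
  (forall W, submodule W -> U `<=` W -> W `<=` V -> W `<=` U \/ V `<=` W) ->
  exists N S (i : {linear N -> M}) (q : {linear N -> S}),
    [/\ injective i, range i = V, surj q, forall x, q x = 0 <-> U (i x)
      & simple_module S].
Proof.
move=> sU sV UV nV mV; have [N [i [ii iV]]] := submodule_ex sV.
have [S [q [qs kq]]] := quotient_ex (submodule_preim i sU).
have qU x : q x = 0 <-> U (i x).
  by have := congr1 (fun U => U x) kq; rewrite /kernel /preimage /= => ->.
exists N, S, i, q; split=> //; split=> [S0|W sW].
  by apply: nV => v; rewrite -iV => -[x _ <-]; apply/qU/S0.
have sW' : submodule (i @` (q @^-1` W)) by apply/submodule_im/submodule_preim.
have [|| h | h] := mV _ sW'.
- move=> u Uu; have : V u by apply: UV.
  rewrite -iV => -[x _ xu]; exists x => //; rewrite /preimage /=.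
  by have [_ ->] := qU x; [apply: submodule0 | rewrite xu].
- by rewrite -iV; apply: image_subset.
- left=> y Wy; have [x xy] := qs y; rewrite -xy; apply/qU/h.
  by exists x => //; rewrite /preimage /= xy.
right=> y; have [x <-] := qs y.
have [|z Wz /ii <-//] := h (i x).
by rewrite -iV; exists x.
Qed.

(* Every simple module is a quotient of [R]; a nonzero map from [R] to it is
   nonzero on some layer of a composition series of [R]. *)
Lemma finitely_many_simples : finite_length R^o ->
  exists n (S : 'I_n -> lmodType R), (forall i, simple_module (S i)) /\
    forall M, simple_module M -> exists i, isomorphic M (S i).
Proof.
move=> cR; pose F (U : set R^o) := exists n (S : 'I_n -> lmodType R),
  (forall i, simple_module (S i)) /\
  forall M (f : {linear R^o -> M}), simple_module M ->
    (exists2 x, U x & f x <> 0) -> exists i, isomorphic M (S i).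
have [|U [sU _ FU mU]] := cR false F.
  exists [set 0]; split=> //; first exact: submodule_zero.
  exists 0%N, (fun=> R^o); split=> [[]//|M f _ [x ->]].
  by rewrite linear0.
have UT : [set: R^o] `<=` U.
  apply: contrapT => nU.
  have [V [sV UV nV mV]] := submodule_cover (cR true) sU nU.
  have [N [X [i [q [ii iV qs qU simX]]]]] := simple_subquotient sU sV UV nV mV.
  apply: nV; apply: mU => //; have [n [S [simS cS]]] := FU.
  exists n.+1, (fun k => oapp S X (unlift ord0 k)); split.
    by move=> k; case: (unlift _ _) => /=.
  move=> M f simM [x Vx fx].
  have [[y Uy fy]|no] := pselect (exists2 y, U y & f y <> 0).
    have [|k kP] := cS M f simM; first by exists y.
    by exists (lift ord0 k); rewrite liftK.
  exists ord0; rewrite unlift_none /=; apply: isomorphic_sym.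
  have [h hP] : exists h : {linear X -> M}, forall y, h (q y) = (f \o i) y.
    apply: factor_ex => // y /qU Uy; apply: contrapT => fy.
    by apply: no; exists (i y).
  apply: (@simple_isomorphic X M h) => //.
  by move: Vx fx; rewrite -iV => -[y _ <-] fy; exists (q y); rewrite hP.
have [n [S [simS cS]]] := FU; exists n, S; split=> // M simM.
have [x xn0] : exists x : M, x <> 0.
  by case: simM => nz _; apply/existsNP.
apply: (cS M (act x)) => //; exists 1; first exact: UT.
by rewrite /= /act scale1r.
Qed.

Lemma complete_simples_ex : finite_length R^o ->
  exists (I : finType) (S : I -> lmodType R), complete_simples S.
Proof.
move=> /finitely_many_simples[n [S [simS cS]]].
(* Only the smallest index of each isomorphism class is kept. *)
pose I := {k : 'I_n | [forall k' : 'I_n,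
  (k' < k)%N ==> ~~ `[<isomorphic (S k) (S k')>]]}.
exists I, (fun i => S (val i)); split=> [i|[i iP] [j jP] /= ij|M simM].
- exact: simS.
- apply: val_inj => /=; apply: val_inj; case: (ltngtP i j) => // lt.
    have /forallP/(_ i)/implyP/(_ lt)/asboolPn := jP.
    by case; apply: isomorphic_sym.
  by have /forallP/(_ j)/implyP/(_ lt)/asboolPn := iP; case.
have ex : exists k,
    [exists i : 'I_n, (i == k :> nat) && `[<isomorphic M (S i)>]].
  have [i iP] := cS M simM; exists i; apply/existsP; exists i.
  by rewrite eqxx; apply/asboolP.
case: (ex_minnP ex) => k /existsP[i /andP[/eqP <-] /asboolP Mi] min.
have iP : [forall k' : 'I_n, (k' < i)%N ==> ~~ `[<isomorphic (S i) (S k')>]].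
  apply/forallP => k'; apply/implyP => lt; apply/asboolPn => ik'.
  have := min k'; rewrite leqNgt lt => /(_ _)/negP; apply=> //.
  apply/existsP; exists k'; rewrite eqxx; apply/asboolP.
  exact: isomorphic_trans ik'.
by exists (exist _ i iP).
Qed.

(* A left ideal [U] minimal among those mapping onto [S] is a projective cover:
   the lift [h : R -> U] of [R -> S] restricts to a surjective, hence bijective
   endomorphism of [U], so that [U] is a direct summand of [R]. *)
Lemma simple_projective_cover S : finite_length R^o -> simple_module S ->
  exists (P : lmodType R) (p : {linear P -> S}),
    projective_cover p /\ finite_length P.
Proof.
move=> cR simS; have [x xn0] : exists x : S, x <> 0.
  by case: simS => nz _; apply/existsNP.
have fs : surj (act x).
  by apply: nonzero_simple_surj => //; exists 1; rewrite /= /act scale1r.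
have [|U [sU _ FU mU]] := cR true [set U | [set: S] `<=` act x @` U].
  by exists setT; split=> // y _; have [z <-] := fs y; exists z.
have [P [i [ii iU]]] := submodule_ex sU.
pose p : {linear P -> S} := act x \o i.
have ps : surj p.
  move=> y; have [//|u + <-] := FU y; rewrite -iU => -[z _ <-].
  by exists z.
have cP : finite_length P := finite_length_inj ii cR.
have supp (V : set P) : submodule V -> [set: S] `<=` p @` V -> forall y, V y.
  move=> sV Vs y; have : U (i y) by rewrite -iU; exists y.
  suff h : U `<=` i @` V by move=> /h[z Vz /ii <-].
  apply: mU => //; first exact: submodule_im.
    by move=> s /Vs[v Vv <-]; exists (i v) => //; exists v.
  by rewrite /= -iU; apply: image_subset.
have [h hP] := @projective_regular R _ _ p (act x) ps.
have his : surj (h \o i).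
  move=> y; have [||z _ <-] := supp (range (h \o i)) _ _ y; last by exists z.
    exact: submodule_range.
  move=> s _; have [z <-] := ps s; exists (h (i z)); first by exists z.
  by rewrite hP.
have hii := surj_endo_inj (cP false) his.
have [g gK] := choice his.
have hig y : h (i (g y)) = y by apply: gK.
have gP a u v : g (a *: u + v) = a *: g u + g v.
  by apply: hii; rewrite /= !linearP !hig.
have pP : projective P.
  apply: (projective_retract (i := i) (r := mklin gP \o h)).
    2: exact: projective_regular.
  by move=> y; apply: hii; apply: (gK (h (i y))).
exists P, p; split=> //; split=> // V sV VP; apply: supp => // s _.
have [y <-] := ps s; have [k [v [pk Vv ->]]] := VP y.
by exists v => //; rewrite linearD pk add0r.
Qed.

End Simples.

(** * Filtrations *)

Section FilteredSubmodules.
Variables (R : nzRingType) (I : finType) (X : I -> lmodType R).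
Implicit Types (M N : lmodType R) (w : seq I).

(* [w] lists the indices of the layers of a filtration of [U], from the top. *)
Inductive filtered M : set M -> seq I -> Prop :=
| Filtered0 (U : set M) : submodule U -> U `<=` [set 0] -> filtered U [::]
| FilteredS (U V : set M) i w : submodule U -> submodule V -> V `<=` U ->
    subquotient_iso U V (X i) -> filtered V w -> filtered U (i :: w).

Lemma filtered_chain M (U : set M) w : filtered U w ->
  exists V : nat -> set M,
    [/\ forall k, submodule (V k), V 0%N = U, V (size w) `<=` [set 0],
        forall k, V k.+1 `<=` V k
      & forall k i0, (k < size w)%N ->
          subquotient_iso (V k) (V k.+1) (X (nth i0 w k))].
Proof.
elim=> {U w} [U sU U0|U V i w sU sV VU iso _ [W [sW W0 Wl Wd Wiso]]].
  by exists (fun=> U); split=> // k i0 /=.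
exists (fun k => if k is k'.+1 then W k' else U); split=> //.
- by case.
- by case=> [|k] //=; rewrite W0.
by case=> [|k] i0 /= => [_|kw]; [rewrite W0 | apply: Wiso].
Qed.

Lemma filtered_filtration M w :
  filtered [set: M] w -> filtration X M (tnth (in_tuple w)).
Proof.
move=> /filtered_chain[V [sV V0 Vl Vd Viso]]; exists V; split=> //.
  by move=> x; rewrite V0.
move=> k; rewrite (tnth_nth (tnth (in_tuple w) k)); apply: Viso.
exact: (ltn_ord k).
Qed.

Lemma multiplicity_tnth w i :
  multiplicity (tnth (in_tuple w)) i = count_mem i w.
Proof.
rewrite /multiplicity -sum1_count big_tnth -sum1_card.
by apply: eq_bigl => k; rewrite inE.
Qed.

Lemma filtered_im M N (i : {linear N -> M}) (U : set N) w :
  injective i -> filtered U w -> filtered (i @` U) w.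
Proof.
move=> ii; elim=> {U w} [U sU U0|U V j w sU sV VU [f [fP fs fV]] _ IH].
  apply: Filtered0; first exact: submodule_im.
  by move=> _ [x /U0 -> <-] /=; rewrite linear0.
apply: FilteredS IH.
- exact: submodule_im.
- exact: submodule_im.
- exact: image_subset.
have /choice[g gE] : forall x, exists z, forall y, i y = x -> z = f y.
  move=> x; have [[y yx]|no] := pselect (exists y, i y = x).
    by exists (f y) => y'; rewrite -yx => /ii ->.
  by exists 0 => y yx; case: no; exists y.
have gi y : g (i y) = f y by apply: gE.
exists g; split=> [a _ _ [x Ux <-] [y Uy <-]|z|_ [x Ux <-]].
- by rewrite -linearP !gi fP.
- by have [y Uy <-] := fs z; exists (i y) => //; exists y.
rewrite gi fV //; split=> [Vx|[y Vy /ii <-//]].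
by exists x.
Qed.

Lemma filtered_preim M N (b : {linear M -> N}) (U : set N) w w' :
  surj b -> filtered U w -> filtered (kernel b) w' ->
  filtered (b @^-1` U) (w ++ w').
Proof.
move=> bs + fk; elim=> {U w} [U sU U0|U V j w sU sV VU [f [fP fs fV]] _ IH].
  suff -> : b @^-1` U = kernel b by [].
  apply/seteqP; split=> x; first exact: U0.
  by rewrite /kernel /preimage /= => ->; apply: submodule0.
apply: FilteredS IH.
- exact: submodule_preim.
- exact: submodule_preim.
- exact: preimage_subset.
exists (f \o b); split=> [a x y Ux Uy|z|x Ux] /=.
- by rewrite linearP fP.
- have [y Uy <-] := fs z; have [x xy] := bs y.
  by exists x; rewrite /preimage /= xy.
exact: fV.
Qed.

(** A maximal submodule with a filtration must be everything, since otherwise a cover of it would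
    add one more simple layer on top. *)
Lemma filtered_ex M : finite_length M ->
  (forall S, simple_module S -> exists i, isomorphic S (X i)) ->
  forall U : set M, submodule U -> exists w, filtered U w.
Proof.
move=> cM cX U0 sU0; have [N [j [ji jU]]] := submodule_ex sU0.
suff [w fw] : exists w, filtered [set: N] w.
  by exists w; rewrite -jU; apply: filtered_im.
have cN := finite_length_inj ji cM.
have [|U [sU _ [w fw] mU]] := cN false [set U | exists w, filtered U w].
  exists [set 0]; split=> //; first exact: submodule_zero.
  by exists [::]; apply: Filtered0 => //; apply: submodule_zero.
suff UT : [set: N] `<=` U.
  by exists w; suff <- : U = setT by []; apply/seteqP.
apply: contrapT => nU.
have [V [sV UV nV mV]] := submodule_cover (cN true) sU nU.
have [Q [S [i [q [ii iV qs qU simS]]]]] := simple_subquotient sU sV UV nV mV.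
have [k [h [h' hK hK']]] := cX S simS.
apply: nV; apply: mU => //; exists (k :: w); apply: FilteredS fw => //.
apply: (subquotient_isoI (q := h \o q) ii iV).
  by move=> y; have [x xy] := qs (h' y); exists x; rewrite /= xy hK'.
move=> x; rewrite -qU /=; split=> [|->]; last by rewrite linear0.
by move=> /(congr1 h'); rewrite hK => ->; rewrite -[X in h' X](linear0 h) hK.
Qed.

End FilteredSubmodules.

(** * Traces and standard modules *)

Section Traces.
Variables (R : nzRingType) (I : finType) (S P : I -> lmodType R).
Variable p : forall i, {linear P i -> S i}.
Hypothesis simS : complete_simples S.
Hypothesis coverP : forall i, projective_cover (p i).
Hypothesis lengthP : forall i, finite_length (P i).
Implicit Types (M N Q : lmodType R) (J : {set I}).

Lemma S_simple i : simple_module (S i).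
Proof. by case: simS. Qed.

Lemma P_projective i : projective (P i).
Proof. by case: (coverP i). Qed.

Lemma p_surj i : surj (p i).
Proof. by case: (coverP i). Qed.

Lemma p_nonzero i : exists x, p i x <> 0.
Proof.
have [nz _] := S_simple i.
have /existsNP[y yn0] := nz; have [x xy] := @p_surj i y.
by exists x; rewrite xy.
Qed.

Lemma cover_full i (V : set (P i)) :
  submodule V -> (exists2 x, V x & p i x <> 0) -> forall x, V x.
Proof.
move=> sV [x Vx px]; have [_ _ sup] := coverP i; apply: sup => // y.
have [_ simSi] := S_simple i.
have [h|h] := simSi _ (submodule_im (p i) sV).
  by case: px; apply: h; exists x.
have [v Vv vy] := h (p i y); exists (y - v), v; split=> //.
  by rewrite linearB vy subrr.
by rewrite subrK.
Qed.

Lemma cover_simple_quotient M i (f : {linear P i -> M}) :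
  simple_module M -> (exists x, f x <> 0) -> isomorphic M (S i).
Proof.
move=> simM fn0; have fs := nonzero_simple_surj simM fn0.
have [h hP] : exists h : {linear M -> S i}, forall x, h (f x) = p i x.
  apply: factor_ex => // x fx; apply: contrapT => px.
  have [y fy] := fn0; case: fy; apply: (cover_full (submodule_ker f)).
  by exists x.
apply: (@simple_isomorphic _ _ _ h) => //; first exact: S_simple.
by have [x px] := @p_nonzero i; exists (f x); rewrite hP.
Qed.

Lemma cover_map_index i j (f : {linear P i -> S j}) :
  (exists x, f x <> 0) -> i = j.
Proof.
move=> /(cover_simple_quotient (S_simple j)) /isomorphic_sym.
by case: simS => _ + _; apply.
Qed.

Lemma simple_quotient_index M (U : set M) :
  finite_length M -> submodule U -> ~ [set: M] `<=` U ->
  exists i (f : {linear M -> S i}), surj f /\ U `<=` kernel f.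
Proof.
move=> cM sU nU; have [Q [f [simQ fs Uf]]] := simple_quotient (cM false) sU nU.
have [_ _ /(_ Q simQ)[i [g [g' gK gK']]]] := simS.
exists i, (g \o f); split=> [y|x /Uf fx].
  by have [x xy] := fs (g' y); exists x; rewrite /= xy gK'.
by rewrite /kernel /= fx linear0.
Qed.

(** Maps into [M] with range in [U] stand for maps into [U], so that traces of submodules can be
    compared inside [M]. *)
Definition trace J M (U : set M) : set M :=
  lspan [set x | exists j (g : {linear P j -> M}),
    [/\ j \in J, range g `<=` U & range g x]].

Lemma submodule_trace J M (U : set M) : submodule (trace J U).
Proof. exact: submodule_lspan. Qed.

Lemma range_trace J M (U : set M) j (g : {linear P j -> M}) :
  j \in J -> range g `<=` U -> range g `<=` trace J U.
Proof. by move=> Jj gU x gx; apply: sub_lspan; exists j, g. Qed.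

Lemma trace_val J M (U : set M) j (g : {linear P j -> M}) y :
  j \in J -> range g `<=` U -> trace J U (g y).
Proof. by move=> Jj gU; apply: (range_trace Jj gU); exists y. Qed.

Lemma trace_min J M (U V : set M) : submodule V ->
  (forall j (g : {linear P j -> M}),
     j \in J -> range g `<=` U -> range g `<=` V) ->
  trace J U `<=` V.
Proof.
by move=> sV h; apply: lspan_sub => // x [j [g [Jj gU gx]]]; apply: (h j g).
Qed.

Lemma trace_sub J M (U : set M) : submodule U -> trace J U `<=` U.
Proof. by move=> sU; apply: trace_min. Qed.

Lemma traceS J J' M (U U' : set M) :
  J \subset J' -> U `<=` U' -> trace J U `<=` trace J' U'.
Proof.
move=> /fintype.subsetP JJ' UU'; apply: trace_min; first exact: submodule_trace.
by move=> j g Jj gU; apply: range_trace; [apply: JJ' | apply: subset_trans UU'].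
Qed.

Lemma trace_im J M N (f : {linear M -> N}) (U : set M) :
  f @` trace J U `<=` trace J (f @` U).
Proof.
move=> _ [x tx <-].
apply: (trace_min (V := f @^-1` trace J (f @` U))) tx.
  exact/submodule_preim/submodule_trace.
move=> j g Jj gU _ [y _ <-].
apply: (@trace_val J N _ j (f \o g)) => //.
by move=> _ [z _ <-]; exists (g z) => //; apply: gU; exists z.
Qed.

Lemma trace_inj J M N (i : {linear N -> M}) (U : set M) :
  injective i -> range i = U -> trace J U = i @` trace J [set: N].
Proof.
move=> ii iU; apply/seteqP; split; last by rewrite -iU; apply: trace_im.
apply: trace_min; first exact/submodule_im/submodule_trace.
move=> j g Jj gU _ [y _ <-].
have [h hP] : exists h : {linear P j -> N}, forall x, i (h x) = g x.
  by apply: lift_ex => //; rewrite iU.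
rewrite -hP; exists (h y) => //.
exact: trace_val.
Qed.

(** A proper trace would be killed by some surjection onto a simple [S i], yet [p i] lifts through
    that surjection to a map from [P i] to [N]. *)
Lemma traceT N : finite_length N -> [set: N] `<=` trace [set: I] [set: N].
Proof.
move=> cN; apply: contrapT.
move=> /(simple_quotient_index cN (submodule_trace _ _))[i [f [fs tf]]].
have [g gP] := P_projective (p i) fs; have [x px] := @p_nonzero i.
apply: px; rewrite -gP; apply: tf; exact: trace_val.
Qed.

(** Finite direct sums of modules [P l], peeled off one summand at a time; [i], [a] are the
    inclusions and [r], [b] the projections of [N = N' + P l]. *)
Inductive sum_of_P (J : {set I}) : lmodType R -> Prop :=
| SumP0 N : zero_module N -> sum_of_P J N
| SumPS N N' l (i : {linear N' -> N}) (r : {linear N -> N'})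
    (a : {linear P l -> N}) (b : {linear N -> P l}) :
    l \in J -> (forall x, r (i x) = x) -> (forall y, b (a y) = y) ->
    (forall x, x = i (r x) + a (b x)) -> sum_of_P J N' -> sum_of_P J N.

(** A simple quotient [S l] of [N] has [l] in [J], because [N] is generated by the [P j] with [j] in
    [J]. The surjection lifts to [b : N -> P l], which is onto since [P l] is a projective cover,
    and therefore splits. *)
Lemma split_cover J N :
  projective N -> finite_length N -> [set: N] `<=` trace J [set: N] ->
  ~ zero_module N ->
  exists N' l (i : {linear N' -> N}) (r : {linear N -> N'})
    (a : {linear P l -> N}) (b : {linear N -> P l}),
    [/\ l \in J, forall x, r (i x) = x, forall y, b (a y) = y
      & forall x, x = i (r x) + a (b x)].
Proof.
move=> pN cN gN nz.
have [|l [f [fs _]]] := simple_quotient_index cN (submodule_zero N).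
  by move=> h; apply: nz => x; apply: h.
have Jl : l \in J.
  apply: contrapT => nJl; have [x px] := @p_nonzero l; apply: px.
  have [y <-] := fs (p l x); suff : kernel f y by [].
  apply: (trace_min (submodule_ker f)) (gN y Logic.I) => j g Jj _ _ [z _ <-].
  apply: contrapT => fgz; apply: nJl.
  by rewrite -(@cover_map_index j l (f \o g)) //; exists z.
have [b bP] := pN _ _ (p l) f (@p_surj l).
have bs : surj b.
  move=> y; have [|z _ <-] := cover_full (submodule_range b) _ y.
    have [x px] := @p_nonzero l; have [z fz] := fs (p l x).
    by exists (b z); [exists z | rewrite bP fz].
  by exists z.
have [a aP] := projective_split (@P_projective l) bs.
have [N' [i [ii iE]]] := submodule_ex (submodule_ker b).
have rP c x y : c *: x + y - a (b (c *: x + y)) =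
    c *: (x - a (b x)) + (y - a (b y)).
  by rewrite 2!linearP scalerBr opprD addrACA.
have [r rE] : exists r : {linear N -> N'}, forall x, i (r x) = mklin rP x.
  apply: lift_ex => //; rewrite iE => _ [x _ <-].
  by rewrite /kernel /= linearB aP subrr.
have bi x : b (i x) = 0 by have : kernel b (i x) by rewrite -iE; exists x.
exists N', l, i, r, a, b; split=> // [x|x].
  by apply: ii; rewrite rE /= bi linear0 subr0.
by rewrite rE /= subrK.
Qed.

Lemma sum_of_PI J N :
  projective N -> finite_length N -> [set: N] `<=` trace J [set: N] ->
  sum_of_P J N.
Proof.
move=> pN cN gN; apply: contrapT => nS.
(* A minimal counterexample among submodules of [N]: splitting off a summand [P l] leaves a smaller
   one. *)
pose F (U : set N) := exists N1 (i : {linear N1 -> N}),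
  [/\ injective i, range i = U, projective N1,
      [set: N1] `<=` trace J [set: N1] & ~ sum_of_P J N1].
have [|U [sU _ [N1 [i [ii iU pN1 gN1 nS1]]] mU]] := cN true F.
  exists setT; split=> //; exists N, idfun; split=> //.
  by apply/seteqP; split=> // x; exists x.
have [//|N' [l [j [r [a [b [Jl rj ba dec]]]]]]] :=
    split_cover pN1 (finite_length_inj ii cN) gN1.
  by move=> z; apply: nS1; apply: SumP0.
have nS' : ~ sum_of_P J N' by move=> /(SumPS Jl rj ba dec)/nS1.
have ji : injective j by apply: can_inj rj.
have sub : U `<=` range (i \o j).
  apply: mU => //; first exact: submodule_range.
    exists N', (i \o j); split=> //.
    - exact: inj_comp.
    - by apply: (projective_retract (i := j) (r := r)).
    move=> x _; rewrite -(rj x).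
    have : trace J (r @` setT) (r (j x)).
      by apply: trace_im; exists (j x) => //; apply: gN1.
    exact: traceS.
  by rewrite -iU => _ [x _ <-]; exists (j x).
(* Minimality forces the complement [N'] to fill [N1], which would make the summand [P l] zero. *)
have [x px] := @p_nonzero l; apply: px.
have [|z _ /ii jz] := sub (i (a x)); first by rewrite -iU; exists (a x).
have aj : a (b (j z)) = 0.
  by apply/(addrI (j (r (j z)))); rewrite -dec rj addr0.
have : a x = 0 by rewrite -(ba x) -jz.
by move=> /(congr1 b); rewrite ba linear0 => ->; rewrite linear0.
Qed.

(** Linear maps carry traces into traces; applied to inclusions and projections, this shows that the
    trace of a direct sum is the sum of the traces. *)
Lemma trace_sum_of_P J J' N :
  (forall l, l \in J -> projective_sub (trace J' [set: P l])) ->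
  sum_of_P J N -> projective_sub (trace J' [set: N]).
Proof.
move=> hJ; elim=> {N} [N N0|N N' l i r a b Jl ri ba dec _ [X [j [ji jX pX]]]].
  exists N, idfun; split=> //.
    apply/seteqP; split=> x; last by exists x.
    by move=> _; rewrite (N0 x); apply: submodule0 (submodule_trace _ _).
  move=> M Q g f gs; exists \0 => x.
  by rewrite (N0 x) linear0 [RHS]linear0.
have [Y [k [ki kY pY]]] := hJ l Jl.
have bi x : b (i x) = 0.
  apply: (can_inj ba); rewrite linear0.
  by apply/(addrI (i (r (i x)))); rewrite -dec ri addr0.
have ra y : r (a y) = 0.
  apply: (can_inj ri); rewrite linear0.
  by apply/(addIr (a (b (a y)))); rewrite -dec ba add0r.
have fP c (x y : X * Y) : i (j (c *: x + y).1) + a (k (c *: x + y).2) =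
    c *: (i (j x.1) + a (k x.2)) + (i (j y.1) + a (k y.2)).
  by rewrite !linearP scalerDr addrACA.
exists (X * Y)%type, (mklin fP); split; last exact: projective_prod.
- move=> [x y] [x' y'] /= E; congr (_, _).
    by have := congr1 r E; rewrite !linearD !ri !ra !addr0 => /ji.
  by have := congr1 b E; rewrite !linearD !bi !ba !add0r => /ki.
apply/seteqP; split=> [_ [[x y] _ <-]|z tz] /=.
  apply: (submoduleD (submodule_trace J' [set: N])).
    suff: trace J' (range i) (i (j x)) by apply: traceS.
    by apply: trace_im; exists (j x) => //; rewrite -jX; exists x.
  suff: trace J' (range a) (a (k y)) by apply: traceS.
  by apply: trace_im; exists (k y) => //; rewrite -kY; exists y.
have [x _ xz] : range j (r z).
  rewrite jX; suff: trace J' (range r) (r z) by apply: traceS.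
  by apply: trace_im; exists z.
have [y _ yz] : range k (b z).
  rewrite kY; suff: trace J' (range b) (b z) by apply: traceS.
  by apply: trace_im; exists z.
by exists (x, y) => //=; rewrite xz yz -dec.
Qed.

Lemma trace_radical J i :
  i \notin J -> trace J [set: P i] `<=` kernel (p i).
Proof.
move=> nJi; apply: trace_min; first exact: submodule_ker.
move=> j g Jj _ _ [y _ <-]; apply: contrapT => pg.
have ij : j = i by apply: (@cover_map_index j i (p i \o g)); exists y.
by move: nJi; rewrite -ij Jj.
Qed.

(** * Removing one index at a time *)

Definition traces_projective J : Prop :=
  forall N, projective N -> finite_length N ->
    projective_sub (trace J [set: N]).

Lemma traces_projectiveT : traces_projective [set: I].
Proof.
move=> N pN cN; exists N, idfun; split=> //.
apply/seteqP; split=> x; last by exists x.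
by move=> _; apply: traceT.
Qed.

Lemma minimal_image_map J j : j \in J ->
  exists i (f : {linear P i -> P j}), [/\ i \in J, exists x, f x <> 0 &
    trace J (kernel (p i)) `<=` kernel f].
Proof.
move=> Jj.
pose F (U : set (P j)) := exists i (f : {linear P i -> P j}),
  [/\ i \in J, exists x, f x <> 0 & range f = U].
have [|U [sU _ [i [f [Ji fn0 fU]]] mU]] := @lengthP j true F.
  exists setT; split=> //; exists j, idfun; split=> //; last first.
    by apply/seteqP; split=> // x; exists x.
  have [x px] := @p_nonzero j; exists x => /= x0.
  by apply: px; rewrite x0 linear0.
exists i, f; split=> //; apply: trace_min; first exact: submodule_ker.
move=> l g Jl gk _ [y _ <-]; apply: contrapT => fgy.
have sub : U `<=` range (f \o g).
  apply: mU => //; first exact: submodule_range.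
    by exists l, (f \o g); split=> //; exists y.
  by rewrite -fU => _ [z _ <-]; exists (g z).
have [_ _ sup] := coverP i; have [x fx] := fn0; apply: fx.
apply: (sup (kernel f)); first exact: submodule_ker.
move=> z; have [|t _ tz] := sub (f z); first by rewrite -fU; exists z.
exists (g t), (z - g t); split; first by apply: gk; exists t.
  by rewrite /kernel /= linearB -tz subrr.
by rewrite addrC subrK.
Qed.

(** A nonzero map to [S i] would lift to a split surjection onto [P i]. Composing its section with
    [j] gives an injective endomorphism of [P i], surjective by the minimum condition, whose image
    lies in [kernel (p i)]. *)
Lemma no_cover_in_radical i (U : set (P i)) N (j : {linear N -> P i}) :
  U `<=` kernel (p i) -> injective j -> range j = U -> projective N ->
  forall f : {linear N -> S i}, forall x, f x = 0.
Proof.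
move=> Uk ji jU pN f x; apply: contrapT => fx.
have [h hP] := pN _ _ (p i) f (@p_surj i).
have hs : surj h.
  move=> y; have [|z _ <-] := cover_full (submodule_range h) _ y.
    by exists (h x); [exists x | rewrite hP].
  by exists z.
have [s sP] := projective_split (@P_projective i) hs.
have jsi : injective (j \o s) by apply: inj_comp => //; apply: can_inj sP.
have jss := inj_endo_surj (@lengthP i true) jsi.
have [y py] := @p_nonzero i; apply: py; have [z <-] := jss y.
by apply: Uk; rewrite -jU; exists (s z).
Qed.

Lemma trace_step J j : kernels_projective R -> traces_projective J -> j \in J ->
  exists i, [/\ i \in J, traces_projective (J :\ i) &
    trace J (kernel (p i)) `<=` trace (J :\ i) [set: P i]].
Proof.
move=> kR tJ Jj; have [i [f [Ji fn0 tf]]] := minimal_image_map Jj.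
have fgP l : finitely_generated (P l) by apply: finite_length_generated.
have [K [u [ui uK pK]]] := kR _ _ f (@P_projective i) (fgP i)
  (@P_projective j) (fgP j).
have kf : kernel f `<=` kernel (p i).
  move=> x fx; apply: contrapT => px; have [y fy] := fn0; apply: fy.
  by apply: (cover_full (submodule_ker f)); exists x.
pose T := trace J (kernel (p i)).
(* Since [f] kills the trace of its radical and [kernel f] lies in the radical, [T] is the trace of
   [kernel f]. That kernel is projective, so the invariant for [J] applies to it. *)
have TE : T = trace J (kernel f).
  apply/seteqP; split; last by apply: traceS.
  apply: trace_min; first exact: submodule_trace.
  move=> l g Jl gk; apply: range_trace => //.
  exact: subset_trans (range_trace Jl gk) tf.
have [N [v [vi vT pN]]] : projective_sub T.
  have cK : finite_length K := finite_length_inj ui (@lengthP i).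
  have [N [v [vi vT pN]]] := tJ K pK cK.
  exists N, (u \o v); split=> //; first exact: inj_comp.
  by rewrite TE (trace_inj J ui uK) -vT image_comp.
have gN : [set: N] `<=` trace J [set: N].
  move=> x _; have Tvx : T (v x) by rewrite -vT; exists x.
  suff : trace J T (v x) by rewrite (trace_inj J vi vT) => -[y ty /vi <-].
  apply: trace_min (Tvx); first exact: submodule_trace.
  by move=> l g Jl gk; apply: range_trace => //; apply: range_trace.
have Tk : T `<=` kernel (p i) by apply: trace_sub; apply: submodule_ker.
have cN : finite_length N := finite_length_inj vi (@lengthP i).
have noS := no_cover_in_radical Tk vi vT pN.
(* Otherwise a simple quotient of [N] kills the trace of [J :\ i] but not every map from the [P k]
   with [k] in [J]. This forces [k = i] and produces a nonzero map from [N] to [S i]. *)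
have gN' : [set: N] `<=` trace (J :\ i) [set: N].
  apply: contrapT.
  move=> /(simple_quotient_index cN (submodule_trace _ _))[l [h [hs th]]].
  have [x px] := @p_nonzero l; apply: px; have [y <-] := hs (p l x).
  apply: (trace_min (submodule_ker h)) (gN y Logic.I) => k g Jk _.
  have [ki|ki] := eqVneq k i; last first.
    by apply: (subset_trans _ th); apply: range_trace => //; rewrite !inE ki.
  move=> _ [z _ <-]; have [//|hgz] := pselect (h (g z) = 0).
  have li : i = l.
    by rewrite -ki; apply: (@cover_map_index k l (h \o g)); exists z.
  by move: (h); rewrite -li => h'; apply: noS.
have TT : T `<=` trace (J :\ i) [set: P i].
  rewrite -vT => _ [x _ <-].
  suff : trace (J :\ i) (range v) (v x) by apply: traceS.
  by apply: trace_im; exists x => //; apply: gN'.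
(* The trace of [J] in [M] is a sum of [P l] with [l] in [J]. On such a summand the trace of
   [J :\ i] is [T] for [l = i] and all of [P l] otherwise. *)
exists i; split=> // M pM cM.
have [X [w [wi wX pX]]] := tJ M pM cM.
have gX : [set: X] `<=` trace J [set: X].
  move=> x _; have tx : trace J [set: M] (w x) by rewrite -wX; exists x.
  suff : trace J (trace J [set: M]) (w x).
    by rewrite (trace_inj J wi wX) => -[y ty /wi <-].
  apply: trace_min (tx); first exact: submodule_trace.
  by move=> l g Jl gk; apply: range_trace => //; apply: range_trace.
have sX := sum_of_PI pX (finite_length_inj wi cM) gX.
have [l Jl|Y [y [yi yY pY]]] := trace_sum_of_P _ sX (J' := J :\ i).
  have [->|li] := eqVneq l i.
    exists N, v; split=> //; rewrite vT; apply/seteqP; split=> //.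
    apply: trace_min; first exact: submodule_trace.
    move=> k g /[!inE]/andP[ki Jk] _; apply: range_trace => //.
    move=> _ [z _ <-].
    apply: (@trace_radical (J :\ i) i); first by rewrite !inE eqxx.
    by apply: trace_val => //; rewrite !inE ki.
  exists (P l), idfun; split=> //; last exact: P_projective.
  apply/seteqP; split=> x; last by exists x.
  move=> _; apply: (@trace_val _ _ _ l idfun) => //.
  by rewrite !inE li.
exists Y, (w \o y); split=> //; first exact: inj_comp.
have -> : trace (J :\ i) [set: M] = trace (J :\ i) (trace J [set: M]).
  apply/seteqP; split; last by apply: traceS.
  apply: trace_min; first exact: submodule_trace.
  move=> l g Jl _; apply: range_trace => //; apply: range_trace => //.
  by move: Jl; rewrite !inE => /andP[].
by rewrite (trace_inj (J :\ i) wi wX) -yY image_comp.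
Qed.

Lemma rank_ex : kernels_projective R ->
  exists rank : I -> nat, injective rank /\ forall i,
    projective_sub (trace [set j | (rank i < rank j)%N] [set: P i]) /\
    trace [set j | (rank i <= rank j)%N] (kernel (p i)) `<=`
      trace [set j | (rank i < rank j)%N] [set: P i].
Proof.
move=> kR; suff h n J : #|J| = n -> traces_projective J ->
    exists rank : I -> nat, {in J &, injective rank} /\ forall i, i \in J ->
    projective_sub (trace [set j in J | (rank i < rank j)%N] [set: P i]) /\
    trace [set j in J | (rank i <= rank j)%N] (kernel (p i)) `<=`
      trace [set j in J | (rank i < rank j)%N] [set: P i].
  have [rank [ri rP]] := h _ _ erefl traces_projectiveT.
  exists rank; split=> [i j|i]; first by apply: ri; rewrite !inE.
  have := rP i (finset.in_setT i).
  have E (r : rel nat) : [set j in [set: I] | r (rank i) (rank j)]%SET =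
      [set j | r (rank i) (rank j)]%SET by apply/setP=> j; rewrite !inE.
  by rewrite (E leq) (E ltn).
elim: n J => [|n IH] J cJ tJ.
  exists (fun=> 0%N); split=> i; first by rewrite (cards0_eq cJ) inE.
  by rewrite (cards0_eq cJ) inE.
have /card_gt0P[j Jj] : (0 < #|J|)%N by rewrite cJ.
have [i [Ji tJi Ti]] := trace_step kR tJ Jj.
have [|rank [ri rP]] := IH (J :\ i) _ tJi.
  by move: (cardsD1 i J); rewrite Ji cJ => -[].
(* The index removed first gets rank 0 and all others move up by one, so the indices of rank at
   least, respectively above, that of [i] are [J] and [J :\ i]. *)
pose rank' x := if x == i then 0%N else (rank x).+1.
exists rank'; split=> [x y Jx Jy|x Jx].
  rewrite /rank'; case: eqVneq => [->|xi]; case: eqVneq => [->|yi] //.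
  by case=> /ri; apply; rewrite !inE ?xi ?yi.
have [->|xi] := eqVneq x i.
  have -> : [set j in J | (rank' i < rank' j)%N]%SET = J :\ i.
    apply/setP=> y; rewrite !inE /rank' eqxx andbC.
    by case: eqVneq.
  have -> : [set j in J | (rank' i <= rank' j)%N]%SET = J.
    by apply/setP=> y; rewrite !inE /rank' eqxx andbT.
  by split=> //; apply: tJi; [apply: P_projective | apply: lengthP].
have := rP x; rewrite !inE xi Jx => /(_ isT).
have -> : [set j in J | (rank' x < rank' j)%N]%SET =
    [set j in J :\ i | (rank x < rank j)%N]%SET.
  apply/setP=> y; rewrite !inE /rank' (negPf xi).
  by case: eqVneq => [->|]; rewrite ?ltn0 ?andbF ?ltnS.
have -> // : [set j in J | (rank' x <= rank' j)%N]%SET =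
    [set j in J :\ i | (rank x <= rank j)%N]%SET.
apply/setP=> y; rewrite !inE /rank' (negPf xi).
by case: eqVneq => [->|]; rewrite ?andbF.
Qed.

(** A layer isomorphic to [S j] is a quotient of a submodule of [U], and [p j] lifts to that
    submodule because [P j] is projective. *)
Lemma filtered_map M (U : set M) w j : filtered S U w -> j \in w ->
  exists g : {linear P j -> M}, range g `<=` U /\ exists y, g y <> 0.
Proof.
elim=> {U w} [//|U V i w sU sV VU [f [fP fs fV]] _ IH].
rewrite inE => /orP[/eqP->|/IH[g [gV gn0]]]; last first.
  by exists g; split=> //; apply: subset_trans VU.
have [N [u [ui uU]]] := submodule_ex sU.
have Uu x : U (u x) by rewrite -uU; exists x.
have fuP a x y : f (u (a *: x + y)) = a *: f (u x) + f (u y).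
  by rewrite linearP fP.
have fus : surj (mklin fuP).
  move=> z; have [x + xz] := fs z; rewrite -uU => -[y _ yx].
  by exists y; rewrite /= yx.
have [h hP] := P_projective (p i) fus.
exists (u \o h); split=> [_ [y _ <-]|]; first exact: Uu.
have [y py] := @p_nonzero i; exists y => uhy; apply: py.
rewrite -hP /=; move: uhy => /= ->; apply/fV; exact: submodule0.
Qed.

(** * Standard modules for a given ranking *)

Section Standard.
Variable rank : I -> nat.

Definition above i : {set I} := [set j | (rank i < rank j)%N].

Hypothesis trace_above_projective :
  forall i, projective_sub (trace (above i) [set: P i]).
Hypothesis trace_radical_above : forall i,
  trace [set j | (rank i <= rank j)%N] (kernel (p i)) `<=`
    trace (above i) [set: P i].

Variables (D : I -> lmodType R) (q : forall i, {linear P i -> D i}).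
Hypothesis q_surj : forall i, surj (q i).
Hypothesis q_ker : forall i, kernel (q i) = trace (above i) [set: P i].

Definition rank_le : rel I := fun i j => (rank i <= rank j)%N.

Lemma q_ker_radical i : kernel (q i) `<=` kernel (p i).
Proof. by rewrite q_ker; apply: trace_radical; rewrite !inE ltnn. Qed.

(** A lower factor [S j] with [rank i <= rank j] would give a nonzero map from [P j] into the
    radical of [D i]. Its lift to [P i] lands in the radical, hence by [trace_radical_above] in
    [kernel (q i)], so the map is zero. *)
Lemma standard_series i : exists w,
  filtered S [set: D i] (i :: w) /\ forall j, j \in w -> (rank j < rank i)%N.
Proof.
have cD : finite_length (D i) := finite_length_surj (@q_surj i) (@lengthP i).
have [h hP] := factor_ex (@q_surj i) (@q_ker_radical i).
have [_ _ cS] := simS.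
have [w fw] := filtered_ex cD cS (submodule_ker h).
exists w; split.
  apply: FilteredS fw => //; first exact: submodule_ker.
  exists h; split=> // [a x y _ _|z]; first by rewrite linearP.
  by have [x <-] := @p_surj i z; exists (q i x).
move=> j /(filtered_map fw)[g [gk [y gy]]]; rewrite ltnNge; apply/negP => le_ij.
have [f fP] := P_projective g (@q_surj i); apply: gy; rewrite -fP.
suff : kernel (q i) (f y) by [].
rewrite q_ker; apply: trace_radical_above; apply: trace_val; rewrite ?inE //.
move=> _ [z _ <-]; rewrite /kernel /= -hP fP; apply: gk; exists z => //.
Qed.

Lemma standard_quotient i : @standard_module R I S P rank_le i (D i) (q i).
Proof.
split=> // [|D' q' q's [l [t [[U [sU U0 Ul Ud Uiso]] tle]]]].
  have [w [fw wlt]] := standard_series i.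
  exists (size (i :: w)), (tnth (in_tuple (i :: w))).
  split; first exact: filtered_filtration.
  move=> k; have /= := mem_tnth k (in_tuple (i :: w)); rewrite inE.
  move=> /orP[/eqP->|/wlt/ltnW //]; exact: leqnn.
suff : trace (above i) [set: P i] `<=` kernel q' by rewrite -q_ker.
apply: trace_min; first exact: submodule_ker.
move=> j g + _ _ [y _ <-]; rewrite inE => lt_ij.
apply: contrapT => qgy.
(* [U k] is the last step of the filtration containing the image of [q' \o g]. On this layer a
   nonzero map [P j -> S (t k)] arises, so [j = t k], against the bound on ranks. *)
have [k [kU [z kz]]] : exists k : 'I_l, range (q' \o g) `<=` U k /\
    exists z, ~ U k.+1 (q' (g z)).
  apply: contrapT => no; apply: qgy; apply: Ul.
  suff h m : (m <= l)%N -> range (q' \o g) `<=` U m.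
    by apply: (h l (leqnn l)); exists y.
  elim: m => [_ x _|m IH ml]; first exact: U0.
  move=> _ [z _ <-]; apply: contrapT => nU; apply: no.
  by exists (Ordinal ml); split; [apply: IH; apply: ltnW | exists z].
have [f [fP fs fV]] := Uiso k.
have Uqg x : U k (q' (g x)) by apply: kU; exists x.
have fgP a x x' : f (q' (g (a *: x + x'))) =
    a *: f (q' (g x)) + f (q' (g x')).
  by rewrite !linearP fP.
have jt : j = t k.
  apply: (@cover_map_index _ _ (mklin fgP)); exists z => /= fz; apply: kz.
  exact/fV.
by have := tle k; rewrite -jt /rank_le leqNgt lt_ij.
Qed.

Lemma sum_of_P_filtered J N :
  (forall l, l \in J -> exists w, filtered D [set: P l] w /\
     forall j, j \in w -> (rank l <= rank j)%N) ->
  sum_of_P J N -> exists w, filtered D [set: N] w /\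
     forall j, j \in w -> exists2 l, l \in J & (rank l <= rank j)%N.
Proof.
move=> hJ; elim=> {N} [N N0|N N' l i r a b Jl ri ba dec _ [w [fw wJ]]].
  by exists [::]; split=> //; apply: Filtered0 => // x _; rewrite /= (N0 x).
have [w' [fw' wl]] := hJ l Jl; exists (w' ++ w); split; last first.
  by move=> j; rewrite mem_cat => /orP[/wl|/wJ //]; exists l.
have bs : surj b by move=> y; exists (a y).
apply: (filtered_preim bs fw').
suff -> : kernel b = range i.
  by apply: filtered_im fw; apply: can_inj ri.
apply/seteqP; split=> [x bx|_ [x _ <-]].
  by exists (r x) => //; rewrite {2}(dec x) bx linear0 addr0.
apply: (can_inj ba); rewrite linear0.
by apply/(addrI (i (r (i x)))); rewrite -dec ri addr0.
Qed.

Lemma kernel_sum_of_P i N (u : {linear N -> P i}) :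
  injective u -> range u = kernel (q i) ->
  projective N /\ sum_of_P (above i) N.
Proof.
move=> ui; rewrite q_ker => uT.
have pN : projective N := projective_subP ui uT (trace_above_projective i).
split=> //; apply: sum_of_PI => //.
  exact: finite_length_inj ui (@lengthP i).
move=> x _; have tx : trace (above i) [set: P i] (u x) by rewrite -uT; exists x.
suff : trace (above i) (trace (above i) [set: P i]) (u x).
  by rewrite (trace_inj (above i) ui uT) => -[y ty /ui <-].
apply: trace_min (tx); first exact: submodule_trace.
by move=> l g Jl gk; apply: range_trace => //; apply: range_trace.
Qed.

Lemma P_filtered i : exists w, filtered D [set: P i] w /\
  forall j, j \in w -> (rank i <= rank j)%N.
Proof.
(* Induction on the distance of [rank i] from the maximal rank: the kernel of [q i] is a sum of
   [P l] of greater rank, and their filtrations are put below the layer [D i]. *)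
have [m] := ubnP (\max_j rank j - rank i)%N.
elim: m i => // m IH i; rewrite ltnS => im.
have [N [u [ui uT]]] := submodule_ex (submodule_ker (q i)).
have [_ /sum_of_P_filtered[l|w [fw wP]]] := kernel_sum_of_P ui uT.
  rewrite inE => il; apply: IH; apply: leq_trans im.
  have lM : (rank l <= \max_j rank j)%N by apply: leq_bigmax.
  by apply: ltn_sub2l => //; apply: leq_trans lM.
exists (i :: w); split=> [|j]; last first.
  rewrite inE => /orP[/eqP-> //|/wP[l]]; rewrite inE => /ltnW il.
  exact: leq_trans.
apply: (FilteredS (V := kernel (q i))) => //; first exact: submodule_ker.
  exists (q i); split=> // [a x y _ _|z]; first by rewrite linearP.
  by have [x <-] := q_surj z; exists x.
by rewrite -uT; apply: filtered_im.
Qed.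

Lemma rank_strongly_quasi_hereditary_pair :
  strongly_quasi_hereditary_pair S P rank_le.
Proof.
exists D, q; split=> i; first exact: standard_quotient.
split.
  have [w [fw wlt]] := standard_series i.
  exists (size (i :: w)), (tnth (in_tuple (i :: w))).
  split; first exact: filtered_filtration.
  rewrite multiplicity_tnth /= eqxx; apply/eqP; rewrite eqSS -leqn0 leqNgt.
  rewrite -has_count; apply/hasPn => j /wlt; apply: contraL => /eqP ->.
  by rewrite ltnn.
have [N [u [ui uT]]] := submodule_ex (submodule_ker (q i)).
have [pN sN] := kernel_sum_of_P ui uT.
exists N, u; split=> //.
  split=> // y; have := congr1 (fun U => U y) uT; rewrite /kernel /= => <-.
  by split=> [[x _ <-]|[x <-]]; exists x.
have [w [fw wP]] := sum_of_P_filtered (fun l _ => P_filtered l) sN.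
exists (size w), (tnth (in_tuple w)); split; first exact: filtered_filtration.
move=> j; rewrite multiplicity_tnth => /eqP; rewrite -lt0n -has_count.
move=> /hasP[k kw /eqP <-]; have [l + lk] := wP k kw.
rewrite inE => il; have ik := leq_trans il lk; split; first exact: ltnW.
by move=> ki; move: ik; rewrite ki ltnn.
Qed.

End Standard.

End Traces.

(** * Artin algebras *)

Lemma artinian_finite_length (R : nzRingType) :
  chain_cond true [set: R^o] -> finite_length R^o.
Proof. by move=> cR [] //; apply: artinian_noetherian_ring. Qed.

Lemma kernels_projective_strongly_quasi_hereditary (B : nzRingType) :
  finite_length (B^c)^o -> kernels_projective B^c ->
  right_strongly_quasi_hereditary B.
Proof.
move=> cR kR; have [I [S simS]] := complete_simples_ex cR.
have [simSi _ _] := simS.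
have /choice[P pP] : forall i, exists P : lmodType B^c,
    exists p : {linear P -> S i}, projective_cover p /\ finite_length P.
  by move=> i; apply: simple_projective_cover.
pose p i := sval (cid (pP i)).
have coverP i : projective_cover (p i) by case: (svalP (cid (pP i))).
have lengthP i : finite_length (P i) by case: (svalP (cid (pP i))).
have [rank [rank_inj rankP]] := rank_ex simS coverP lengthP kR.
have /choice[D qP] : forall i, exists D : lmodType B^c,
    exists q : {linear P i -> D}, surj q /\
      kernel q = trace P (above rank i) [set: P i].
  by move=> i; apply: quotient_ex; apply: submodule_trace.
pose q i := sval (cid (qP i)).
have q_surj i : surj (q i) by case: (svalP (cid (qP i))).
have q_ker i : kernel (q i) = trace P (above rank i) [set: P i].
  by case: (svalP (cid (qP i))).
exists I, S, P, p, (rank_le rank); split=> //.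
  split=> [i|i j|j i k]; first exact: leqnn.
    by rewrite /rank_le -eqn_leq => /eqP/rank_inj.
  exact: leq_trans.
apply: (rank_strongly_quasi_hereditary_pair simS coverP lengthP _ _ q_surj
          q_ker).
  by move=> i; case: (rankP i).
by move=> i; case: (rankP i).
Qed.

Section ArtinAlgebra.
Variables (k : comNzRingType) (A : algType k).
Hypothesis artinA : artin_algebra A.

(* Left and right ideals of [A] are [k]-submodules. *)
Lemma artin_algebra_chain_cond (B : nzRingType) (f : B -> A) (g : A -> B) :
  cancel f g -> cancel g f -> (forall x y, f (x + y) = f x + f y) ->
  (forall c x, f (g c%:A * x) = c *: f x) -> chain_cond true [set: B^o].
Proof.
move=> fK gK fD fZ; have [ak fgA] := artinA.
have cA : chain_cond true [set: A].
  by apply: finitely_generated_chain_cond fgA; apply: artinian_chain_cond.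
have f0 : f 0 = 0 by apply: (addrI (f 0)); rewrite -fD !addr0.
have sub (X : set B^o) : submodule X -> X `<=` setT ->
    submodule (g @^-1` X : set A) /\ g @^-1` X `<=` [set: A].
  move=> sX _; split=> //; split=> [|a x y Xx Xy].
    by rewrite /preimage /= -f0 fK; apply: (submodule0 sX).
  rewrite /preimage /=.
  have -> : g (a *: x + y) = (g a%:A : B) *: (g x : B^o) + g y.
    apply: (can_inj fK); rewrite gK fD gK -[g a%:A *: _]/(g a%:A * g x) fZ.
    by rewrite gK.
  by case: sX => _; apply.
apply: (chain_cond_pull cA cA sub sub) => [X Y XY x /XY//|X Y XY x /XY//|].
move=> X Y _ _ _ _ YX _ y Yy; have := YX (f y).
by rewrite /preimage /= fK; apply.
Qed.

End ArtinAlgebra.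

Lemma gl_dim2_strongly_quasi_hereditary (B : nzRingType) :
  chain_cond true [set: (B^c)^o] -> chain_cond true [set: (B^c^c)^o] ->
  right_gl_dim_le B 2 ->
  right_strongly_quasi_hereditary B /\ left_strongly_quasi_hereditary B.
Proof.
move=> /artinian_finite_length cr /artinian_finite_length cl.
move=> /gl_dim2_kernels_projective kB.
split; first exact: kernels_projective_strongly_quasi_hereditary.
have kBc := kernels_projective_conv cr cl kB.
exact: (kernels_projective_strongly_quasi_hereditary (B := B^c)).
Qed.

Theorem theorem1p3 (k : comNzRingType) (A : algType k) :
  artin_algebra A ->
  right_gl_dim_le A 2 ->
  right_strongly_quasi_hereditary A /\ left_strongly_quasi_hereditary A.
Proof.
move=> artinA; pose B : nzRingType := A.
apply: (@gl_dim2_strongly_quasi_hereditary B).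
  apply: (@artin_algebra_chain_cond k A artinA B^c idfun idfun) => // c x.
  exact: mulr_algr.
apply: (@artin_algebra_chain_cond k A artinA B^c^c idfun idfun) => // c x.
exact: mulr_algl.
Qed.
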